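(* Let $F=\mathrm{Diag}(a_1,\dots,a_d)\in M_d(\mathbb Z)$ with all $a_j>0$ and $G\in M_d(\mathbb Z)$ with $\det G\ne0$. For $k\in\mathbb N\cup\{0\}$ let $$\mathcal A_k=\overline{\mathrm{span}}\{S_\alpha U^\nu S_\beta^* : |\alpha|=|\beta|=k,\ \nu\in\mathbb Z^d\}.$$ Then $\mathcal A_k$ is a unital $*$-subalgebra of $\mathcal O_{F,G}(\mathbb T^d)^\gamma$ with $\mathcal A_k\subset\mathcal A_{k+1}$. Moreover, $$\mathcal O_{F,G}(\mathbb T^d)^\gamma=\overline{\bigcup_k\mathcal A_k}.$$
   Context: For $F\in M_d(\mathbb Z)$, $\sigma_F$ is the endomorphism of $\mathbb T^d$ given by $\sigma_F(e^{2\pi it})=e^{2\pi iFt}$, $t\in\mathbb R^d$. For $F,G\in M_d(\mathbb Z)$ with nonzero determinants let $\Omega_{F,G}(\mathbb T^d)=\{(x,y)\in\mathbb T^d\times\mathbb T^d:\sigma_F(y)=\sigma_G(x)\}$. The $C^*$-correspondence $\mathcal E=\mathcal E_{F,G}(\mathbb T^d)$ over $C(\mathbb T^d)$ is $C(\Omega_{F,G}(\mathbb T^d))$ with actions $(a\cdot\xi\cdot b)(x,y)=a(y)\xi(x,y)b(x)$ and inner product $\langle\xi,\eta\rangle(x)=\frac1{|\det F|}\sum_{\sigma_F(y)=\sigma_G(x)}\overline{\xi(x,y)}\eta(x,y)$. $\mathcal O_{F,G}(\mathbb T^d)$ is its Cuntz-Pimsner algebra, i.e. the $C^*$-algebra generated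 by the universal pair $(T,\pi)$ ($T$ linear on $\mathcal E$, $\pi$ a $*$-homomorphism of $A=C(\mathbb T^d)$) with $T(\xi)^*T(\eta)=\pi(\langle\xi,\eta\rangle)$, $T(a\cdot\xi)=\pi(a)T(\xi)$ and $\Psi_T(\phi(a))=\pi(a)$ for $a\in\phi^{-1}(\mathcal K(\mathcal E))\cap(\ker\phi)^\perp$, where $\phi$ is the left action, $(\ker\phi)^\perp=\{a:ab=0\ \forall b\in\ker\phi\}$, and $\Psi_T(\theta_{\xi,\eta})=T(\xi)T(\eta)^*$, $\theta_{\xi,\eta}(\zeta)=\xi\langle\eta,\zeta\rangle$. Here $\mathfrak I(F)=\{\nu\in\mathbb Z^d:0\le\nu_j\le a_j-1\}$; $U_j\in\mathcal O_{F,G}(\mathbb T^d)$ is the image of the coordinate function $y\mapsto y_j$; $U^\nu=\prod_jU_j^{\nu_j}$ for $\nu\in\mathbb Z^d$; $S=T(1)$, the image of the constant function $1\in C(\Omega_{F,G}(\mathbb T^d))$; $S_\nu=U^\nu S$ for $\nu\in\mathfrak I(F)$; for $\alpha=(\alpha_1,\dots,\alpha_k)\in\mathfrak I(F)^k$, $|\alpha|=k$ and $S_\alpha=S_{\alpha_1}\cdots S_{\alpha_k}$ (with $S_\alpha=1$ for the empty tuple). Equivalently, $\mathcal O_{F,G}(\mathbb T^d)$ is the universal $C^*$-algebra generated by commuting unitaries $U_1,\dots,U_d$ and an isometry $S$ with $S^*U^\nu S=\delta_0^\nu$ ($\nu\in\mathfrak I(F)$), $U_j^{a_j}S=SU^{G_j}$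 ($G_j$ the $j$-th row of $G$), and $\sum_{\nu\in\mathfrak I(F)}U^\nu SS^*U^{-\nu}=1$. The gauge action $\gamma:\mathbb T\to\mathrm{Aut}(\mathcal O_{F,G}(\mathbb T^d))$ is $\gamma_t(S)=tS$, $\gamma_t(U_j)=U_j$; the fixed point algebra $\mathcal O_{F,G}(\mathbb T^d)^\gamma$ is $\{x:\gamma_t(x)=x\ \forall t\in\mathbb T\}$. *)

(* Defs.v *)
From HB Require Import structures.
From mathcomp Require Import all_boot all_order all_algebra.
From mathcomp Require Import all_classical all_reals topology normedtype trigo.
From mathcomp Require Import complex ring.

Set Implicit Arguments.
Unset Strict Implicit.
Unset Printing Implicit Defensive.

Import Order.TTheory GRing.Theory Num.Theory.
Import numFieldNormedType.Exports.

Local Open Scope classical_set_scope.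
Local Open Scope ring_scope.

Reserved Notation "x ** y" (at level 40, left associativity).

(* R[i] seen through its numClosedFieldType structure, so that the topology and
   the norm of numClosedFieldTypes are found by inference. *)
Definition Cplx (R : realType) : numClosedFieldType := R[i].

Definition cabs (R : realType) (z : Cplx R) : R := ComplexField.Normc.normc z.

HB.mixin Record isStarAlgebra (R : realType) A of GRing.Lmodule (Cplx R) A := {
  smul : A -> A -> A;
  star : A -> A;
  smulA : associative smul;
  smulDl : left_distributive smul +%R;
  smulDr : right_distributive smul +%R;
  smulZl : forall (c : Cplx R) x y, smul (c *: x) y = c *: smul x y;
  smulZr : forall (c : Cplx R) x y, smul x (c *: y) = c *: smul x y;
  starK : involutive star;
  starD : {morph star : x y / x + y};
  starZ : forall (c : Cplx R) x, star (c *: x) = c^* *: star x;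
  starM : forall x y, star (smul x y) = smul (star y) (star x)
}.

(* Associative complex *-algebras, not necessarily unital. *)
#[short(type="starAlgType")]
HB.structure Definition StarAlgebra (R : realType) :=
  {A of GRing.Lmodule (Cplx R) A & isStarAlgebra R A}.

Notation "x ** y" := (smul x y) : ring_scope.

HB.mixin Record isCStarAlgebra (R : realType) A
    of CompleteNormedModule (Cplx R) A & StarAlgebra R A := {
  norm_smul : forall x y : A, `|x ** y| <= `|x| * `|y|;
  cstar_norm : forall x : A, `|star x ** x| = `|x| ^+ 2
}.

#[short(type="cstarAlgType")]
HB.structure Definition CStarAlgebra (R : realType) :=
  {A of CompleteNormedModule (Cplx R) A & StarAlgebra R A & isCStarAlgebra R A}.

Record star_hom (R : realType) (A B : starAlgType R) (f : A -> B) : Prop := {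
  star_hom_linear : linear f;
  star_hom_mul : {morph f : x y / x ** y};
  star_hom_star : {morph f : x / star x}
}.

Record star_subalgebra (R : realType) (A : starAlgType R) (D : set A) : Prop := {
  star_subalgebra0 : D 0;
  star_subalgebraP : forall (c : Cplx R) x y, D x -> D y -> D (c *: x + y);
  star_subalgebraM : forall x y, D x -> D y -> D (x ** y);
  star_subalgebra_star : forall x, D x -> D (star x)
}.

Definition is_identity (R : realType) (A : starAlgType R) (e : A) : Prop :=
  forall x, e ** x = x /\ x ** e = x.

Definition lspan (K : pzRingType) (V : lmodType K) (X : set V) : set V :=
  [set x | exists (n : nat) (c : 'I_n -> K) (v : 'I_n -> V),
     (forall i, X (v i)) /\ x = \sum_(i < n) c i *: v i].

Section continuous_functions.
Variables (R : realType) (X : topologicalType).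
Local Notation CX := (continuousType X (Cplx R)).
Implicit Types f g : CX.

Let cf0_cts : continuous (fun _ : X => 0 : Cplx R).
Proof. by move=> x; exact: cvg_cst. Qed.
Let cfN_cts f : continuous (fun x => - f x).
Proof. by move=> x; apply: cvgN; exact: cts_fun. Qed.
Let cfD_cts f g : continuous (fun x => f x + g x).
Proof. by move=> x; apply: cvgD; exact: cts_fun. Qed.
Let cfZ_cts (c : Cplx R) f : continuous (fun x => c * f x).
Proof. by move=> x; apply: cvgM; [exact: cvg_cst | exact: cts_fun]. Qed.
Let cfM_cts f g : continuous (fun x => f x * g x).
Proof. by move=> x; apply: cvgM; exact: cts_fun. Qed.
Let cfC_cts f : continuous (fun x => (f x)^*).
Proof.
move=> x; apply/cvgrPdist_lt => e e0.
have /cvgrPdist_lt/(_ e e0) := @cts_fun _ _ f x.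
by apply: filterS => y; rewrite -rmorphB norm_conjC.
Qed.

Let cf0 : CX := mkcts cf0_cts.
Let cfN f : CX := mkcts (@cfN_cts f).
Let cfD f g : CX := mkcts (@cfD_cts f g).
Let cfZ (c : Cplx R) f : CX := mkcts (@cfZ_cts c f).
Let cfM f g : CX := mkcts (@cfM_cts f g).
Let cfC f : CX := mkcts (@cfC_cts f).

Let cfDA : associative cfD.
Proof. by move=> f g h; apply/continuousEP => x; exact: addrA. Qed.
Let cfDC : commutative cfD.
Proof. by move=> f g; apply/continuousEP => x; exact: addrC. Qed.
Let cf0D : left_id cf0 cfD.
Proof. by move=> f; apply/continuousEP => x; exact: add0r. Qed.
Let cfND : left_inverse cf0 cfN cfD.
Proof. by move=> f; apply/continuousEP => x; exact: addNr. Qed.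

HB.instance Definition _ := GRing.isZmodule.Build CX cfDA cfDC cf0D cfND.

Let cfZA (a b : Cplx R) f : cfZ a (cfZ b f) = cfZ (a * b) f.
Proof. by apply/continuousEP => x; exact: mulrA. Qed.
Let cfZ1 : left_id 1 cfZ.
Proof. by move=> f; apply/continuousEP => x; exact: mul1r. Qed.
Let cfZDr : right_distributive cfZ +%R.
Proof. by move=> c f g; apply/continuousEP => x; exact: mulrDr. Qed.
Let cfZDl f : {morph cfZ^~ f : a b / a + b}.
Proof. by move=> a b; apply/continuousEP => x; exact: mulrDl. Qed.

HB.instance Definition _ :=
  GRing.Zmodule_isLmodule.Build (Cplx R) CX cfZA cfZ1 cfZDr cfZDl.

Let cfMA : associative cfM.
Proof. by move=> f g h; apply/continuousEP => x; exact: mulrA. Qed.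
Let cfMDl : left_distributive cfM +%R.
Proof. by move=> f g h; apply/continuousEP => x; exact: mulrDl. Qed.
Let cfMDr : right_distributive cfM +%R.
Proof. by move=> f g h; apply/continuousEP => x; exact: mulrDr. Qed.
Let cfMZl (c : Cplx R) f g : cfM (c *: f) g = c *: cfM f g.
Proof. by apply/continuousEP => x; exact/esym/mulrA. Qed.
Let cfMZr (c : Cplx R) f g : cfM f (c *: g) = c *: cfM f g.
Proof. by apply/continuousEP => x; exact: mulrCA. Qed.
Let cfCK : involutive cfC.
Proof. by move=> f; apply/continuousEP => x; exact: conjCK. Qed.
Let cfCD : {morph cfC : f g / f + g}.
Proof. by move=> f g; apply/continuousEP => x; exact: rmorphD. Qed.
Let cfCZ (c : Cplx R) f : cfC (c *: f) = c^* *: cfC f.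
Proof. by apply/continuousEP => x; exact: rmorphM. Qed.
Let cfCM f g : cfC (cfM f g) = cfM (cfC g) (cfC f).
Proof. by apply/continuousEP => x; rewrite /= /mkcts rmorphM mulrC. Qed.

HB.instance Definition _ := isStarAlgebra.Build R CX
  cfMA cfMDl cfMDr cfMZl cfMZr cfCK cfCD cfCZ cfCM.

Let cf1_cts : continuous (fun _ : X => 1 : Cplx R).
Proof. by move=> x; exact: cvg_cst. Qed.
Definition cf1 : CX := mkcts cf1_cts.

Definition sup_norm f : R := sup [set cabs (f x) | x in setT].

End continuous_functions.
Arguments cf1 {R X}.

Section set_type_continuity.
Variables (X Y : topologicalType) (D : set X).

Lemma val_continuous : continuous (val : D -> X).
Proof. exact: initial_continuous. Qed.

Lemma comp_val_continuous (f : X -> Y) :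
  continuous f -> continuous (fun x : D => f (val x)).
Proof.
by move=> f_cts x; exact: (continuous_comp (@val_continuous x) (f_cts (val x))).
Qed.

Lemma cvg_set_type (I : Type) (FI : set_system I) (f : I -> D) (l : D) :
  Filter FI -> val (f x) @[x --> FI] --> val l -> f x @[x --> FI] --> l.
Proof.
move=> FFI h A /= [_ [[B oB <-] Bl] sA].
have : nbhs (val l) B by exact: open_nbhs_nbhs.
by move=> nB; apply: (@filterS _ FI FFI _ _ _ (h _ nB)) => x Bx; exact: sA.
Qed.

End set_type_continuity.

Section torus.
Variables (R : realType) (d : nat).

Definition torus : Type :=
  set_type [set z : 'rV[Cplx R]_d | forall j, `|z 0 j| = 1].

HB.instance Definition _ := Topological.on torus.

Lemma torus_norm (z : torus) j : `|val z 0 j| = 1.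
Proof. exact: set_valP z j. Qed.

Lemma torus_coord_cts j : continuous (fun z : torus => val z 0 j).
Proof.
exact: (@comp_val_continuous _ _ _ (fun v : 'rV[Cplx R]_d => v 0 j)
  (@coord_continuous _ _ _ 0 j)).
Qed.

Definition torus_coord j : continuousType torus (Cplx R) := mkcts (@torus_coord_cts j).

Lemma torus_endo_subproof (F : 'M[int]_d) (z : torus) :
  (\row_j \prod_(k < d) val z 0 k ^ F j k)
    \in [set z : 'rV[Cplx R]_d | forall j, `|z 0 j| = 1].
Proof.
rewrite inE => j; rewrite mxE normr_prod big1 // => k _.
by case: (F j k) => n; rewrite ?normfV normrX torus_norm expr1n ?invr1.
Qed.

(* The coordinates of e^{2 pi i F t} are the monomials
   \prod_k (e^{2 pi i t_k})^(F j k), see torus_endo_exp. *)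
Definition torus_endo (F : 'M[int]_d) (z : torus) : torus :=
  SigSub (torus_endo_subproof F z).

End torus.

Section correspondence.
Variables (R : realType) (d : nat) (F G : 'M[int]_d).
Local Notation TT := (torus R d).
Local Notation A := (continuousType TT (Cplx R)).

Definition Omega : Type :=
  set_type [set p : TT * TT | torus_endo F p.2 = torus_endo G p.1].

HB.instance Definition _ := Topological.on Omega.

Local Notation E := (continuousType Omega (Cplx R)).

Lemma Omega_fst_cts : continuous (fun p : Omega => (val p).1).
Proof.
exact: (@comp_val_continuous _ _ _ (fun p : TT * TT => p.1)
  (fun p => @cvg_fst _ _ (nbhs p.1) (nbhs p.2) _)).
Qed.

Lemma Omega_snd_cts : continuous (fun p : Omega => (val p).2).
Proof.
exact: (@comp_val_continuous _ _ _ (fun p : TT * TT => p.2)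
  (fun p => @cvg_snd _ _ (nbhs p.1) (nbhs p.2) _)).
Qed.

(* The left action uses y and the right action uses x, for p = (x, y). *)
Definition lact (a : A) (xi : E) : E := (a \o mkcts Omega_snd_cts : E) ** xi.
Definition ract (xi : E) (a : A) : E := xi ** (a \o mkcts Omega_fst_cts : E).

Definition ip_fun (xi eta : E) (x : TT) : Cplx R :=
  (`|\det F|%N)%:R^-1 *
  \sum_(p \in [set p : Omega | (val p).1 = x]) (xi p)^* * eta p.

(* The default value is never used when \det F != 0, see ipE. *)
Definition ip (xi eta : E) : A :=
  if pselect (continuous (ip_fun xi eta)) is left h then mkcts h else 0.

Definition theta (xi eta zeta : E) : E := ract xi (ip eta zeta).

Definition corr_norm (xi : E) : R := Num.sqrt (sup_norm (ip xi xi)).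

Definition compact_op (k : E -> E) : Prop :=
  forall e : R, 0 < e -> exists (n : nat) (xi eta : 'I_n -> E), forall zeta : E,
    corr_norm (k zeta - \sum_(i < n) theta (xi i) (eta i) zeta)
      <= e * corr_norm zeta.

Definition adjoint_of (k l : E -> E) : Prop :=
  forall xi eta, ip (k xi) eta = ip xi (l eta).

(* Psi restricts to a *-homomorphism K(E) -> B with
   Psi (theta xi eta) = T xi ** star (T eta); its values outside K(E) are
   irrelevant. *)
Record compact_hom (B : cstarAlgType R) (T : E -> B) (Psi : (E -> E) -> B)
    : Prop := {
  compact_hom_linear : forall (c : Cplx R) k l, compact_op k -> compact_op l ->
    Psi (fun zeta => c *: k zeta + l zeta) = c *: Psi k + Psi l;
  compact_hom_mul : forall k l, compact_op k -> compact_op l ->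
    Psi (k \o l) = Psi k ** Psi l;
  compact_hom_star : forall k l, compact_op k -> compact_op l ->
    adjoint_of k l -> Psi l = star (Psi k);
  compact_hom_theta : forall xi eta, Psi (theta xi eta) = T xi ** star (T eta)
}.

Record covariant_pair (B : cstarAlgType R) (T : E -> B) (pi : A -> B)
    : Prop := {
  covariant_linear : linear T;
  covariant_hom : star_hom pi;
  covariant_ip : forall xi eta, star (T xi) ** T eta = pi (ip xi eta);
  covariant_lact : forall a xi, T (lact a xi) = pi a ** T xi;
  covariant_compact : exists Psi : (E -> E) -> B, compact_hom T Psi /\
    forall a : A, compact_op (lact a) ->
      (forall b : A, (forall xi, lact b xi = 0) -> a ** b = 0) ->
      Psi (lact a) = pi a
}.

Record cuntz_pimsner (O : cstarAlgType R) (T : E -> O) (pi : A -> O)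
    : Prop := {
  cuntz_pimsner_pair : covariant_pair T pi;
  cuntz_pimsner_gen : forall D : set O, star_subalgebra D -> closed D ->
    (forall xi, D (T xi)) -> (forall a, D (pi a)) -> D = setT;
  cuntz_pimsner_univ : forall (B : cstarAlgType R) (T' : E -> B) (pi' : A -> B),
    covariant_pair T' pi' -> exists! rho : O -> B,
      [/\ star_hom rho, forall xi, rho (T xi) = T' xi
        & forall a, rho (pi a) = pi' a]
}.

Section generators.
Variables (O : cstarAlgType R) (T : E -> O) (pi : A -> O).

Definition gen_one : O := pi cf1.
Definition gen_U (j : 'I_d) : O := pi (torus_coord R j).
Definition gen_S : O := T cf1.

Definition gen_pow (u : O) (n : int) : O :=
  match n with
  | Posz m => iter m (smul u) gen_one
  | Negz m => iter m.+1 (smul (star u)) gen_one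
  end.

Definition gen_Upow (nu : 'rV[int]_d) : O :=
  \big[smul/gen_one]_(j < d) gen_pow (gen_U j) (nu 0 j).

Definition gen_Snu (nu : 'rV[int]_d) : O := gen_Upow nu ** gen_S.

Definition gen_Salpha (alpha : seq 'rV[int]_d) : O :=
  \big[smul/gen_one]_(nu <- alpha) gen_Snu nu.

Record gauge_action (gamma : Cplx R -> O -> O) : Prop := {
  gauge_hom : forall t, `|t| = 1 -> star_hom (gamma t);
  gauge_bij : forall t, `|t| = 1 -> bijective (gamma t);
  gauge_mul : forall s t, `|s| = 1 -> `|t| = 1 ->
    gamma (s * t) =1 gamma s \o gamma t;
  gauge_S : forall t, `|t| = 1 -> gamma t gen_S = t *: gen_S;
  gauge_U : forall t j, `|t| = 1 -> gamma t (gen_U j) = gen_U j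
}.

Definition gauge_fixed (gamma : Cplx R -> O -> O) : set O :=
  [set x | forall t, `|t| = 1 -> gamma t x = x].

End generators.

End correspondence.

Definition index_set (d : nat) (a : 'rV[int]_d) : set 'rV[int]_d :=
  [set nu | forall j, 0 <= nu 0 j <= a 0 j - 1].

Definition core_level (R : realType) (d : nat) (a : 'rV[int]_d) (G : 'M[int]_d)
    (O : cstarAlgType R)
    (T : continuousType (Omega R (diag_mx a) G) (Cplx R) -> O)
    (pi : continuousType (torus R d) (Cplx R) -> O) (k : nat) : set O :=
  closure (lspan [set x | exists (alpha beta : k.-tuple 'rV[int]_d)
                                (nu : 'rV[int]_d),
    [/\ forall i, index_set a (tnth alpha i),
        forall i, index_set a (tnth beta i)
      & x = gen_Salpha T pi alpha ** gen_Upow pi nu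
              ** star (gen_Salpha T pi beta)]]).

Section exponential.
Variables (R : realType) (d : nat).

Definition cexp (s : R) : Cplx R := (cos s +i* sin s)%C.

Lemma cexpD s t : cexp (s + t) = cexp s * cexp t.
Proof.
rewrite /cexp cosD sinD; apply/eqP; rewrite eq_complex /= eqxx /=.
by rewrite addrC.
Qed.

Lemma cexp0 : cexp 0 = 1.
Proof. by rewrite /cexp cos0 sin0. Qed.

Lemma cexp_neq0 s : cexp s != 0.
Proof.
apply/eqP => s0; have := cexpD s (- s).
by rewrite subrr cexp0 s0 mul0r => /eqP; rewrite oner_eq0.
Qed.

Lemma cexp_norm s : `|cexp s| = 1.
Proof. by rewrite normc_def /= cos2Dsin2 sqrtr1. Qed.

Lemma cexpMz (n : int) s : cexp (n%:~R * s) = cexp s ^ n.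
Proof.
have pos m : cexp (m%:R * s) = cexp s ^+ m.
  elim: m => [|m IH]; first by rewrite mul0r cexp0 expr0.
  by rewrite exprS -IH -cexpD -natr1 mulrDl mul1r addrC.
case: n => n; first exact: pos.
apply: (mulfI (cexp_neq0 (n.+1%:R * s))).
rewrite -cexpD {1}NegzE mulrNz mulNr subrr cexp0 pos.
by apply/esym/mulfV; rewrite expf_neq0 ?cexp_neq0.
Qed.

Lemma torus_exp_subproof (t : 'rV[R]_d) : (\row_j cexp (2 * pi * t 0 j))
  \in [set z : 'rV[Cplx R]_d | forall j, `|z 0 j| = 1].
Proof. by rewrite inE => j; rewrite mxE cexp_norm. Qed.

Definition torus_exp (t : 'rV[R]_d) : torus R d := SigSub (torus_exp_subproof t).

Lemma torus_endo_exp (F : 'M[int]_d) (t : 'rV[R]_d) :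
  torus_endo F (torus_exp t) = torus_exp (t *m (map_mx intr F)^T).
Proof.
apply/val_inj/rowP => j; rewrite mxE [RHS]mxE mxE mulr_sumr.
rewrite (big_morph cexp cexpD cexp0); apply: eq_bigr => k _.
by rewrite mxE -cexpMz !mxE; congr cexp; ring.
Qed.

End exponential.

Section inner_product.
Variables (R : realType) (d : nat).
Local Notation C := (Cplx R).
Local Notation TT := (torus R d).
Implicit Types (z w : TT) (F G : 'M[int]_d).

Lemma torus_ext z w : (forall j, val z 0 j = val w 0 j) -> z = w.
Proof. by move=> h; apply/val_inj/rowP. Qed.

Lemma torus_neq0 z j : val z 0 j != 0.
Proof. by rewrite -normr_eq0 torus_norm oner_eq0. Qed.

Lemma torus_mul_subproof z w : (\row_j (val z 0 j * val w 0 j))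
  \in [set z : 'rV[Cplx R]_d | forall j, `|z 0 j| = 1].
Proof. by rewrite inE => j; rewrite mxE normrM !torus_norm mulr1. Qed.

Lemma torus_inv_subproof z : (\row_j (val z 0 j)^-1)
  \in [set z : 'rV[Cplx R]_d | forall j, `|z 0 j| = 1].
Proof. by rewrite inE => j; rewrite mxE normfV torus_norm invr1. Qed.

Definition torus_mul z w : TT := SigSub (torus_mul_subproof z w).
Definition torus_inv z : TT := SigSub (torus_inv_subproof z).

Lemma torus_mulE z w j : val (torus_mul z w) 0 j = val z 0 j * val w 0 j.
Proof. by rewrite mxE. Qed.

Lemma torus_invE z j : val (torus_inv z) 0 j = (val z 0 j)^-1.
Proof. by rewrite mxE. Qed.

Lemma torus_endoE F z j :
  val (torus_endo F z) 0 j = \prod_(k < d) val z 0 k ^ F j k.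
Proof. by rewrite mxE. Qed.

Lemma torus_endoM F z w :
  torus_endo F (torus_mul z w) = torus_mul (torus_endo F z) (torus_endo F w).
Proof.
apply: torus_ext => j; rewrite [LHS]torus_endoE [RHS]torus_mulE.
rewrite [X in _ = X * _]torus_endoE [X in _ = _ * X]torus_endoE -big_split/=.
by apply: eq_bigr => k _; rewrite (torus_mulE z) expfzMl.
Qed.

Lemma torus_endo_comp F G z :
  torus_endo F (torus_endo G z) = torus_endo (F *m G) z.
Proof.
apply: torus_ext => j; rewrite !torus_endoE.
under eq_bigr do rewrite torus_endoE.
have h k : (\prod_(l < d) val z 0 l ^ G k l) ^ F j k =
   \prod_(l < d) val z 0 l ^ (F j k * G k l).
  rewrite (big_morph (fun x : C => x ^ F j k) (id1 := 1) (op1 := *%R)).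
  - by apply: eq_bigr => l _; rewrite exprz_exp mulrC.
  - by move=> x y; rewrite expfzMl.
  - by rewrite exp1rz.
under eq_bigr do rewrite h.
rewrite exchange_big/=; apply: eq_bigr => l _; rewrite mxE.
rewrite (big_morph (fun n : int => val z 0 l ^ n) (id1 := 1) (op1 := *%R)) //.
by move=> m n; rewrite expfzDr// torus_neq0.
Qed.

Lemma torus_endo_scalar (n : int) z j :
  val (torus_endo n%:M z) 0 j = val z 0 j ^ n.
Proof.
rewrite torus_endoE (bigD1 j)//= big1 ?mulr1; first by rewrite mxE eqxx mulr1n.
by move=> k kj; rewrite mxE eq_sym (negbTE kj).
Qed.

Lemma root_near1 (n : nat) (w : C) : (0 < n)%N ->
  exists r : C, r ^+ n = w /\ `|1 - r| ^+ n <= `|1 - w|.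
Proof.
move=> n0; have [s hs] := closed_field_poly_normal ('X^n - w%:P : {poly C}).
have hm : 'X^n - w%:P \is monic by rewrite monicXnsubC.
move: hs; rewrite (monicP hm) scale1r => hs.
have size_s : size s = n.
  by have := size_XnsubC w n0; rewrite hs size_prod_XsubC => -[].
have rootE r : r \in s -> r ^+ n = w.
  move=> rs; apply/eqP; rewrite -subr_eq0.
  have : root (\prod_(z <- s) ('X - z%:P)) r by rewrite root_prod_XsubC.
  by rewrite -hs /root !hornerE.
have e1 : `|1 - w| = \prod_(r <- s) `|1 - r|.
  have := congr1 (horner^~ 1) hs; rewrite !hornerE expr1n => ->.
  rewrite horner_prod normr_prod.
  by apply: eq_bigr => r _; rewrite !hornerE.
have [/hasP[r rs hr]|/hasPn h] :=
    boolP (has (fun r : C => `|1 - r| ^+ n <= `|1 - w|) s).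
  by exists r; split => //; exact: rootE.
exfalso.
have lt r : r \in s -> `|1 - w| < `|1 - r| ^+ n.
  by move=> /h; rewrite -real_ltNge// ?realX// normr_real.
have : \prod_(r <- s) `|1 - w| < \prod_(r <- s) `|1 - r| ^+ n.
  rewrite big_seq [ltRHS]big_seq; apply: ltr_prod; last first.
    by move=> r /lt ->; rewrite normr_ge0.
  by apply/hasP; exists (nth 0 s 0); rewrite mem_nth// size_s.
by rewrite big_const_seq count_predT size_s iter_mulr_1 prodrXl -e1 ltxx.
Qed.


Section limits.
Variables (I : Type) (FI : set_system I).
Context {FFI : Filter FI}.

Lemma cvg_exprz (f : I -> C) (l : C) (n : int) : l != 0 ->
  f x @[x --> FI] --> l -> f x ^ n @[x --> FI] --> l ^ n.
Proof.
move=> l0 fl; have pos m : f x ^+ m @[x --> FI] --> l ^+ m.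
  elim: m => [|m IH]; first exact: cvg_cst.
  have -> : (fun x => f x ^+ m.+1) = (fun x => f x * f x ^+ m).
    by apply/funext => x; rewrite exprSr mulrC.
  by rewrite [l ^+ _]exprSr mulrC; exact: (cvgM fl IH).
by case: n => n; [exact: pos | apply: cvgV; [rewrite expf_neq0|exact: pos]].
Qed.

Lemma cvg_prodC (K : Type) (r : seq K) (f : K -> I -> C) (l : K -> C) :
  (forall k, f k x @[x --> FI] --> l k) ->
  \prod_(k <- r) f k x @[x --> FI] --> \prod_(k <- r) l k.
Proof.
move=> fl; elim: r => [|k r IH].
  by rewrite big_nil; under eq_cvg do rewrite big_nil; exact: cvg_cst.
rewrite big_cons; under eq_cvg do rewrite big_cons.
exact: (cvgM (fl k) IH).
Qed.

Lemma cvg_sumC (K : Type) (r : seq K) (f : K -> I -> C) (l : K -> C) :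
  (forall k, f k x @[x --> FI] --> l k) ->
  \sum_(k <- r) f k x @[x --> FI] --> \sum_(k <- r) l k.
Proof.
move=> fl; elim: r => [|k r IH].
  by rewrite big_nil; under eq_cvg do rewrite big_nil; exact: cvg_cst.
rewrite big_cons; under eq_cvg do rewrite big_cons.
exact: (cvgD (fl k) IH).
Qed.

Lemma cvg_torus (f : I -> TT) (l : TT) :
  (forall j, val (f x) 0 j @[x --> FI] --> val l 0 j) -> f x @[x --> FI] --> l.
Proof.
move=> h; apply: cvg_set_type => A [B hB sA].
have : FI (fun x => forall j, B 0 j (val (f x) 0 j)).
  by apply: filter_forall => j; exact: (h j _ (hB 0 j)).
move=> hF; apply: (@filterS _ FI FFI _ _ _ hF) => x hx.
by apply: sA => i j; rewrite (ord1 i).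
Qed.

Lemma cvg_torus_coord (f : I -> TT) (l : TT) j :
  f x @[x --> FI] --> l -> val (f x) 0 j @[x --> FI] --> val l 0 j.
Proof. by move=> h; exact: (cvg_comp _ _ h (@torus_coord_cts R d j l)). Qed.

Lemma cvg_torus_endo F (f : I -> TT) (l : TT) :
  f x @[x --> FI] --> l -> torus_endo F (f x) @[x --> FI] --> torus_endo F l.
Proof.
move=> h; apply: cvg_torus => j; rewrite torus_endoE.
under eq_cvg do rewrite torus_endoE.
apply: cvg_prodC => k; apply: cvg_exprz; first exact: torus_neq0.
exact: cvg_torus_coord.
Qed.

Lemma cvg_torus_mul (f g : I -> TT) (l m : TT) :
  f x @[x --> FI] --> l -> g x @[x --> FI] --> m ->
  torus_mul (f x) (g x) @[x --> FI] --> torus_mul l m.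
Proof.
move=> fl gm; apply: cvg_torus => j; rewrite (torus_mulE l m).
under eq_cvg => x do rewrite (torus_mulE (f x)).
exact: (cvgM (cvg_torus_coord (j := j) fl) (cvg_torus_coord (j := j) gm)).
Qed.

End limits.



Section fibres.
Variables (F G : 'M[int]_d) (detF : \det F != 0).
Local Notation N := `|\det F|%N.
Local Notation OM := (Omega R F G).

Let N_gt0 : (0 < N)%N. Proof. by rewrite absz_gt0. Qed.

Let FA : exists A : 'M[int]_d, F *m A = N%:Z%:M /\ A *m F = N%:Z%:M.
Proof.
exists (sgz (\det F) *: \adj F).
rewrite -scalemxAr -scalemxAl mul_mx_adj mul_adj_mx -mul_scalar_mx.
by rewrite -scalar_mxM -abszEsg.
Qed.

Lemma torus_root_exists (w : TT) : exists r : TT,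
  torus_endo N%:Z%:M r = w /\
  forall j, `|1 - val r 0 j| ^+ N <= `|1 - val w 0 j|.
Proof.
have [r hr] := choice (fun j => root_near1 (val w 0 j) N_gt0).
have r1 : (\row_j r j) \in [set z : 'rV[Cplx R]_d | forall j, `|z 0 j| = 1].
  rewrite inE => j; rewrite mxE; apply/eqP.
  rewrite -(@pexpr_eq1 _ _ N) ?normr_ge0//.
  by rewrite -normrX (hr j).1 torus_norm.
exists (SigSub r1 : TT); split.
  by apply: torus_ext => j; rewrite torus_endo_scalar /= mxE; exact: (hr j).1.
by move=> j; rewrite /= mxE; exact: (hr j).2.
Qed.

Lemma torus_section_exists : exists s : TT -> TT,
  (forall w, torus_endo F (s w) = w) /\
  forall (I : Type) (FI : set_system I), Filter FI ->
  forall w : I -> TT, (forall j, val (w x) 0 j @[x --> FI] --> (1 : C)) ->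
  forall j, val (s (w x)) 0 j @[x --> FI] --> (1 : C).
Proof.
have [A [FA1 _]] := FA.
have [r hr] := choice torus_root_exists.
exists (torus_endo A \o r); split=> [w|I FI FFI w hw j].
  by rewrite /= torus_endo_comp FA1 (hr w).1.
have hr1 k : val (r (w x)) 0 k @[x --> FI] --> (1 : C).
  apply/cvgrPdist_lt => e e0.
  have eN : 0 < e ^+ N by rewrite exprn_gt0.
  have /cvgrPdist_lt/(_ _ eN) := hw k.
  apply: filterS => x /(le_lt_trans ((hr (w x)).2 k)).
  by rewrite ltr_pXn2r ?nnegrE ?normr_ge0 ?ltW.
have e1 : \prod_(k < d) (1 : C) ^ A j k = 1.
  by rewrite big1 // => k _; rewrite exp1rz.
rewrite -[X in _ --> X]e1; under eq_cvg do rewrite /= torus_endoE.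
by apply: cvg_prodC => k; apply: cvg_exprz; [exact: oner_neq0 | exact: hr1].
Qed.

Lemma fibre_finite (x : TT) : finite_set [set p : OM | (val p).1 = x].
Proof.
have [A [_ AF]] := FA.
pose w := torus_endo A (torus_endo G x).
have [rs hrs] : exists rs : 'I_d -> seq C,
    forall j (z : C), z ^+ N = val w 0 j -> z \in rs j.
  have /choice[rs hrs] : forall j, exists rs : seq C,
      forall z : C, z ^+ N = val w 0 j -> z \in rs.
    move=> j.
    have [s hs] := closed_field_poly_normal ('X^N - (val w 0 j)%:P : {poly C}).
    exists s => z hz.
    have hm : 'X^N - (val w 0 j)%:P \is monic by rewrite monicXnsubC.
    move: hs; rewrite (monicP hm) scale1r => hs.
    by rewrite -root_prod_XsubC -hs /root !hornerE hz subrr.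
  by exists rs.
pose ss := flatten [seq rs j | j <- enum 'I_d].
pose g (f : {ffun 'I_d -> seq_sub ss}) : 'rV[C]_d := \row_j val (f j).
have fing : finite_set (g @` setT) by apply: finite_image; exact: finite_finset.
pose h (p : OM) : 'rV[C]_d := val (val p).2.
have hinj : {in [set p : OM | (val p).1 = x] &, injective h}.
  move=> p q; rewrite !inE => px qx pq; apply: val_inj.
  rewrite [LHS]surjective_pairing [RHS]surjective_pairing px qx.
  by congr pair; exact: val_inj.
rewrite -(eq_finite_set (inj_card_eq hinj)).
apply: sub_finite_set fing => _ [p px <-].
have mem j : h p 0 j \in ss.
  apply/flattenP; exists (rs j); first by apply: map_f; rewrite mem_enum.
  apply: hrs; rewrite -[LHS](torus_endo_scalar N%:Z (val p).2 j) -AF -torus_endo_comp.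
  by rewrite (set_valP p) px.
exists [ffun j => SeqSub (mem j)] => //.
by apply/rowP => j; rewrite mxE ffunE.
Qed.

Lemma cvg_ip_fun (xi eta : continuousType OM (Cplx R)) (FI : set_system TT)
    (x0 : TT) : Filter FI -> x @[x --> FI] --> x0 ->
  ip_fun xi eta x @[x --> FI] --> ip_fun xi eta x0.
Proof.
move=> FFI x_x0.
have [s [sK s1]] := torus_section_exists.
pose q x := torus_mul x (torus_inv x0).
have q1 j : val (q x) 0 j @[x --> FI] --> (1 : C).
  rewrite -[X in _ --> X](divff (torus_neq0 x0 j)).
  under eq_cvg => x do rewrite (torus_mulE x) torus_invE.
  exact: (cvgMr_tmp (cvg_torus_coord (j := j) x_x0)).
pose u x := s (torus_endo G (q x)).
have u1 j : val (u x) 0 j @[x --> FI] --> (1 : C).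
  apply: s1 => k.
  have e1 : \prod_(l < d) (1 : C) ^ G k l = 1.
    by rewrite big1 // => l _; rewrite exp1rz.
  rewrite -[X in _ --> X]e1; under eq_cvg do rewrite torus_endoE.
  by apply: cvg_prodC => l; apply: cvg_exprz; [exact: oner_neq0 | exact: q1].
have tauP x (p : OM) :
  (torus_mul (q x) (val p).1, torus_mul (u x) (val p).2) \in
  [set p : TT * TT | torus_endo F p.2 = torus_endo G p.1].
  by rewrite inE /= 2!torus_endoM /u sK (set_valP p).
pose tau x p : OM := SigSub (tauP x p).
have tau_bij x : set_bij [set p : OM | (val p).1 = x0]
    [set p : OM | (val p).1 = x] (tau x).
  split.
  - move=> p /= ->; apply: torus_ext => j.
    by rewrite !torus_mulE torus_invE divfK ?torus_neq0.
  - move=> p p'; rewrite !inE => px px' /(congr1 (fun r : OM => (val r).2)) e0.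
    have e : torus_mul (u x) (val p).2 = torus_mul (u x) (val p').2 := e0.
    apply: val_inj; rewrite [LHS]surjective_pairing [RHS]surjective_pairing.
    rewrite px px'; congr pair; apply: torus_ext => j.
    apply: (mulfI (torus_neq0 (u x) j)).
    by rewrite -!torus_mulE e.
  - move=> p /= px.
    pose y := torus_mul (torus_inv (u x)) (val p).2.
    have yP : (x0, y) \in [set p : TT * TT | torus_endo F p.2 = torus_endo G p.1].
      rewrite inE /=; apply: torus_ext => j.
      apply: (mulfI (torus_neq0 (torus_endo G (q x)) j)).
      rewrite -{1}(sK (torus_endo G (q x))) -!torus_mulE -!torus_endoM.
      have -> : torus_mul (s (torus_endo G (q x))) y = (val p).2.
        apply: torus_ext => k.
        by rewrite !torus_mulE torus_invE mulVKf ?torus_neq0.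
      have -> : torus_mul (q x) x0 = x.
        apply: torus_ext => k.
        by rewrite !torus_mulE torus_invE divfK ?torus_neq0.
      by rewrite (set_valP p) px.
    exists (SigSub yP : OM) => //; apply: val_inj.
    rewrite [RHS]surjective_pairing /=; congr pair; apply: torus_ext => j.
      by rewrite !torus_mulE torus_invE divfK ?torus_neq0 ?px.
    by rewrite !torus_mulE torus_invE mulVKf ?torus_neq0.
pose f (p : OM) := (xi p)^* * eta p.
have ipE x : ip_fun xi eta x =
    (N%:R)^-1 * \sum_(p <- finmap.enum_fset (fset_set [set p : OM | (val p).1 = x0])) f (tau x p).
  rewrite /ip_fun (reindex_fsbig _ _ _ _ (tau_bij x)) fsbig_finite//.
  exact: fibre_finite.
have ipE0 : ip_fun xi eta x0 =
    (N%:R)^-1 * \sum_(p <- finmap.enum_fset (fset_set [set p : OM | (val p).1 = x0])) f p.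
  by rewrite /ip_fun fsbig_finite//; exact: fibre_finite.
rewrite ipE0; under eq_cvg do rewrite ipE.
apply: cvgMl_tmp; apply: cvg_sumC => p.
have f_cts : continuous f.
  exact: (@cts_fun _ _ (star xi ** eta)).
have near1 (v : TT -> TT) (z : TT) :
    (forall j, val (v x) 0 j @[x --> FI] --> (1 : C)) ->
    torus_mul (v x) z @[x --> FI] --> z.
  move=> v1; apply: cvg_torus => j; rewrite -[X in _ --> X]mul1r.
  under eq_cvg => x do rewrite (torus_mulE (v x)).
  exact: (cvgMr_tmp (v1 j)).
have tau_p : tau x p @[x --> FI] --> p.
  apply: cvg_set_type; rewrite [val p]surjective_pairing.
  exact: (cvg_pair (near1 _ _ q1) (near1 _ _ u1)).
exact: (cvg_comp _ _ tau_p (f_cts p)).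
Qed.

Lemma ip_fun_continuous (xi eta : continuousType OM (Cplx R)) :
  continuous (ip_fun xi eta).
Proof. by move=> x; exact: (@cvg_ip_fun _ _ (nbhs x) x _ cvg_id). Qed.

End fibres.

Lemma ipE (F G : 'M[int]_d) (xi eta : continuousType (Omega R F G) (Cplx R)) (x : TT) :
  \det F != 0 -> ip xi eta x = ip_fun xi eta x.
Proof.
move=> detF; rewrite /ip; case: pselect => // h; exfalso.
exact/h/ip_fun_continuous.
Qed.

End inner_product.

Section gauge_existence.
Variables (R : realType) (d : nat) (F G : 'M[int]_d) (O : cstarAlgType R).
Variables (T : continuousType (Omega R F G) (Cplx R) -> O)
          (pi : continuousType (torus R d) (Cplx R) -> O).
Hypothesis OTpi : cuntz_pimsner T pi.

Let spec (t : Cplx R) (rho : O -> O) := [/\ star_hom rho,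
  forall xi, rho (T xi) = t *: T xi & forall a, rho (pi a) = pi a].

Let twisted_pair (t : Cplx R) :
  `|t| = 1 -> covariant_pair (fun xi => t *: T xi) pi.
Proof.
move=> t1; have tt : t^* * t = 1 by rewrite mulrC -normCK t1 expr1n.
case: (cuntz_pimsner_pair OTpi) => lT hpi ipT lactT [Psi [hPsi cPsi]].
split => //.
- by move=> c xi eta; rewrite lT scalerDr !scalerA mulrC.
- by move=> xi eta; rewrite starZ smulZl smulZr scalerA tt scale1r.
- by move=> a xi; rewrite lactT smulZr.
- exists Psi; split => //; case: hPsi => l m s th; split => // xi eta.
  by rewrite starZ smulZl smulZr scalerA mulrC tt scale1r.
Qed.

Let spec_exists (t : Cplx R) : `|t| = 1 -> exists! rho, spec t rho.
Proof. by move=> t1; exact: cuntz_pimsner_univ OTpi _ _ _ (twisted_pair t1). Qed.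

Let spec_id : spec 1 id.
Proof. by split => // xi; rewrite scale1r. Qed.

Let spec_comp (s t : Cplx R) rho rho' :
  spec s rho -> spec t rho' -> spec (s * t) (rho \o rho').
Proof.
case=> -[l m st] hT hpi [[l' m' st'] hT' hpi']; split.
- split => [c x y|x y|x] /=; [by rewrite l' l|by rewrite m' m|by rewrite st' st].
- move=> xi /=; rewrite hT'; have l0 : rho 0 = 0.
    by have := l (-1) 0 0; rewrite scaler0 addr0 scaleN1r addNr.
  by have := l t (T xi) 0; rewrite !addr0 l0 addr0 => ->; rewrite hT scalerA mulrC.
- by move=> a /=; rewrite hpi' hpi.
Qed.

Lemma gauge_action_exists : exists gamma, gauge_action T pi gamma.
Proof.
have [gamma gammaP] : {gamma & forall t, `|t| = 1 -> spec t (gamma t)}.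
  apply: (@choice _ _ (fun t rho => `|t| = 1 -> spec t rho)) => t.
  have [/spec_exists[rho [h _]]|nt] := pselect (`|t| = 1); first by exists rho.
  by exists id.
have uniq t rho rho' : `|t| = 1 -> spec t rho -> spec t rho' -> rho = rho'.
  by move=> /spec_exists[r [_ u]] /u <- /u <-.
have mul s t : `|s| = 1 -> `|t| = 1 -> gamma (s * t) = gamma s \o gamma t.
  move=> s1 t1; have st1 : `|s * t| = 1 by rewrite normrM s1 t1 mulr1.
  by apply: (uniq _ _ _ st1); [exact: gammaP | apply: spec_comp; exact: gammaP].
have one : gamma 1 = id by apply: (uniq 1); rewrite ?normr1//; apply: gammaP; rewrite normr1.
exists gamma; split.
- by move=> t /gammaP[].
- move=> t t1; have t0 : t != 0 by rewrite -normr_eq0 t1 oner_eq0.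
  have u1 : `|t^-1| = 1 by rewrite normfV t1 invr1.
  exists (gamma t^-1) => x.
    by rewrite -[LHS]/((gamma t^-1 \o gamma t) x) -mul // mulVf // one.
  by rewrite -[LHS]/((gamma t \o gamma t^-1) x) -mul // mulfV // one.
- by move=> s t s1 t1 x; rewrite mul.
- by move=> t /gammaP[_ + _]; apply.
- by move=> t j /gammaP[_ _]; apply.
Qed.

End gauge_existence.

(* Main.v *)
(* The unitaries U^nu span a dense subspace of the image of C(T^d), and the
   correspondence has the finite frame y^nu, nu in I(F): a character sum over
   the fibres of sigma_F gives S_mu^* S_nu = delta_{mu,nu} 1 and, through
   covariance, sum_nu S_nu S_nu^* = 1. Inserting this sum in the middle of
   S_alpha U^nu S_beta^* lengthens both words by one letter; this gives
   A_k <= A_{k+1} and lets any two such elements be multiplied after bringing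
   the inner words to the same length, so that these elements span a dense
   *-subalgebra. Averaging the gauge action over the n-th roots of unity is
   bounded uniformly in n, is the identity on gauge-fixed elements, and, once n
   exceeds the lengths involved, kills the S_alpha U^nu S_beta^* with
   |alpha| <> |beta|. Applied to an approximation of a fixed point, it yields an
   approximation by elements of the A_k.

   Spectral theory is avoided: if h is self-adjoint and small then
   h = (u + u^* )/2 with u = h + i sqrt(1 - h^2) unitary, so a *-homomorphism
   sends h to an element of norm at most 1. Density of the trigonometric
   polynomials is a Korovkin argument with the kernel prod_j |1 + z_j/w_j|^(2n)
   sampled at w_j in the roots of unity. *)

Require Import Defs.
From HB Require Import structures.
From mathcomp Require Import all_boot all_order all_algebra all_solvable all_field.
From mathcomp Require Import all_classical all_reals topology normedtype sequences.
From mathcomp Require Import realfun trigo complex ring lra zify.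

Set Implicit Arguments.
Unset Strict Implicit.
Unset Printing Implicit Defensive.

Import Order.TTheory GRing.Theory Num.Theory.
Import numFieldNormedType.Exports.

Local Open Scope classical_set_scope.
Local Open Scope ring_scope.

(** * Continuity and bounds in C*-algebras *)

(** Only additivity is assumed, so that the conjugate-linear [star] is covered along with
    multiplications and *-homomorphisms. *)
Lemma bounded_additive_continuous (K : numFieldType) (V W : normedModType K)
    (f : V -> W) (C : K) : 0 < C -> {morph f : x y / x - y} ->
  (forall x, `|f x| <= C * `|x|) -> continuous f.
Proof.
move=> C0 fB fC x; apply/cvgrPdist_lt => e e0.
have eC : 0 < e / C by rewrite divr_gt0.
have /cvgrPdist_lt/(_ _ eC) := @cvg_id _ (nbhs x).
apply: filterS => y xy; rewrite -fB (le_lt_trans (fC _))//.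
by rewrite mulrC -ltr_pdivlMr.
Qed.

Lemma closure_normP (K : numFieldType) (V : normedModType K) (D : set V) (x : V) :
  closure D x <-> forall e, 0 < e -> exists2 y, D y & `|x - y| < e.
Proof.
split=> [cl e e0|h B /nbhs_ballP[e /= e0 eB]].
  have [y [Dy]] := cl _ (nbhsx_ballx x e e0).
  by rewrite -ball_normE; exists y.
have [y Dy xy] := h e e0; exists y; split => //; apply: eB.
by rewrite -ball_normE.
Qed.

(** The preimage of [closure E] is closed and contains [D]. This extends algebraic closure
    properties from a set to its closure, one variable at a time. *)
Lemma closure_preimage (X Y : topologicalType) (f : X -> Y) (D : set X) (E : set Y) :
  continuous f -> (forall x, D x -> closure E (f x)) ->
  forall x, closure D x -> closure E (f x).
Proof.
move=> fc DE x Dx.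
have cl : closed (f @^-1` closure E).
  by apply: closed_comp => [y _|]; [exact: fc | exact: closed_closure].
by have := closure_subset DE Dx; rewrite -(closure_id _).1.
Qed.

Section span.
Variables (K : pzRingType) (V : lmodType K).
Implicit Types (X D : set V).

Lemma lspan_linear X (c : K) x y :
  lspan X x -> lspan X y -> lspan X (c *: x + y).
Proof.
move=> [n [a [v [Xv ->]]]] [m [b [w [Xw ->]]]].
exists (n + m)%N, (fun i => match fintype.split i with inl i => c * a i | inr i => b i end),
  (fun i => match fintype.split i with inl i => v i | inr i => w i end); split.
  by move=> i; case: fintype.split.
rewrite big_split_ord scaler_sumr /=; congr +%R; apply: eq_bigr => i _.
  by rewrite (unsplitK (inl i : 'I_n + 'I_m)) scalerA.
by rewrite (unsplitK (inr i : 'I_n + 'I_m)).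
Qed.

Lemma lspan0 X : lspan X 0.
Proof.
exists 0, (fun=> 0), (fun=> 0); split; first by case.
by rewrite big_ord0.
Qed.

Lemma sub_lspan X : X `<=` lspan X.
Proof.
move=> x Xx; exists 1, (fun=> 1), (fun=> x); split => //.
by rewrite big_ord1 scale1r.
Qed.

(** The induction principle for spans: [D] is instantiated with the property to be proved. *)
Lemma lspan_min X D : D 0 -> (forall c x y, D x -> D y -> D (c *: x + y)) ->
  X `<=` D -> lspan X `<=` D.
Proof.
move=> D0 DP XD _ [n [c [v [Xv ->]]]].
elim/big_ind : _ => // [x y Dx Dy|i _]; first by rewrite -[x]scale1r; exact: DP.
by rewrite -[_ *: _]addr0; apply: DP => //; exact/XD.
Qed.

End span.

Section star_algebra.
Variables (R : realType) (A : starAlgType R).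
Implicit Types x y z : A.

Lemma smul0r x : 0 ** x = 0.
Proof. by rewrite -[0 in LHS](scale0r (0 : A)) smulZl scale0r. Qed.
Lemma smulr0 x : x ** 0 = 0.
Proof. by rewrite -[0 in LHS](scale0r (0 : A)) smulZr scale0r. Qed.
Lemma smulNr x y : (- x) ** y = - (x ** y).
Proof. by rewrite -scaleN1r smulZl scaleN1r. Qed.
Lemma smulrN x y : x ** (- y) = - (x ** y).
Proof. by rewrite -scaleN1r smulZr scaleN1r. Qed.
Lemma smulBl x y z : (x - y) ** z = x ** z - y ** z.
Proof. by rewrite smulDl smulNr. Qed.
Lemma smulBr x y z : z ** (x - y) = z ** x - z ** y.
Proof. by rewrite smulDr smulrN. Qed.
Lemma star0 : star (0 : A) = 0.
Proof. by rewrite -[0 in LHS](scale0r (0 : A)) starZ rmorph0 scale0r. Qed.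
Lemma starN x : star (- x) = - star x.
Proof. by rewrite -scaleN1r starZ rmorphN rmorph1 scaleN1r. Qed.
Lemma starB x y : star (x - y) = star x - star y.
Proof. by rewrite starD starN. Qed.
Lemma smul_suml I (r : seq I) (P : pred I) (F : I -> A) x :
  (\sum_(i <- r | P i) F i) ** x = \sum_(i <- r | P i) (F i ** x).
Proof. by rewrite (big_morph (fun y => y ** x) (fun y z => smulDl y z x) (smul0r x)). Qed.
Lemma smul_sumr I (r : seq I) (P : pred I) (F : I -> A) x :
  x ** (\sum_(i <- r | P i) F i) = \sum_(i <- r | P i) (x ** F i).
Proof. by rewrite (big_morph (smul x) (smulDr x) (smulr0 x)). Qed.

(** Products of generators need only fall into the span: a product of two words may be 0, or a sum
    of longer words. *)
Lemma star_subalgebra_lspan (X : set A) :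
  (forall x y, X x -> X y -> lspan X (x ** y)) ->
  (forall x, X x -> X (star x)) -> star_subalgebra (lspan X).
Proof.
move=> XM Xs; split; [exact: lspan0 | by move=> *; exact: lspan_linear | |].
- move=> x y; move: x; apply: lspan_min => [Xy||x Xx].
  + by rewrite smul0r; exact: lspan0.
  + move=> c u v hu hv Xy; rewrite smulDl smulZl.
    by apply: lspan_linear; [exact: hu | exact: hv].
  + move: y; apply: lspan_min => [||y Xy]; last exact: XM.
      by rewrite smulr0; exact: lspan0.
    by move=> c u v hu hv; rewrite smulDr smulZr; exact: lspan_linear.
- apply: lspan_min => [||x Xx]; first by rewrite star0; exact: lspan0.
    by move=> c u v hu hv; rewrite starD starZ; exact: lspan_linear.
  exact/sub_lspan/Xs.
Qed.

End star_algebra.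

Section star_hom_theory.
Variables (R : realType) (A B : starAlgType R) (f : A -> B).
Hypothesis hf : star_hom f.

Lemma star_hom0 : f 0 = 0.
Proof.
by have := star_hom_linear hf (-1) 0 0; rewrite scaler0 addr0 scaleN1r addNr.
Qed.
Lemma star_homZ c x : f (c *: x) = c *: f x.
Proof. by have := star_hom_linear hf c x 0; rewrite !addr0 star_hom0 addr0. Qed.
Lemma star_homD : {morph f : x y / x + y}.
Proof. by move=> x y; have := star_hom_linear hf 1 x y; rewrite !scale1r. Qed.
Lemma star_homB : {morph f : x y / x - y}.
Proof. by move=> x y; rewrite star_homD -scaleN1r star_homZ scaleN1r. Qed.

End star_hom_theory.

Section cstar_algebra.
Variables (R : realType) (A : cstarAlgType R).
Implicit Types (x y u p : A) (D : set A).

Lemma norm_star x : `|star x| = `|x|.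
Proof.
have le y : `|y| <= `|star y|.
  have [->|y0] := eqVneq y 0; first by rewrite star0.
  have : `|y| * `|y| <= `|star y| * `|y|.
    by rewrite -expr2 -cstar_norm norm_smul.
  by rewrite ler_pM2r // normr_gt0.
by apply/le_anti; rewrite le andbT -{2}[x]starK le.
Qed.

Lemma star_continuous : continuous (@star R A).
Proof.
apply: (@bounded_additive_continuous (Cplx R) A A _ 1) => // [x y|x].
  by rewrite starB.
by rewrite norm_star mul1r.
Qed.

Lemma smull_continuous y : continuous (smul y).
Proof.
apply: (@bounded_additive_continuous (Cplx R) A A _ (`|y| + 1)) => [|x z|x].
- by rewrite ltr_wpDl.
- by rewrite smulBr.
- by rewrite (le_trans (norm_smul _ _))// ler_wpM2r// lerDl.
Qed.

Lemma smulr_continuous y : continuous (smul^~ y).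
Proof.
apply: (@bounded_additive_continuous (Cplx R) A A _ (`|y| + 1)) => [|x z|x].
- by rewrite ltr_wpDl.
- by rewrite smulBl.
- by rewrite (le_trans (norm_smul _ _))// mulrC ler_wpM2r// lerDl.
Qed.

Lemma norm_projection p : star p = p -> p ** p = p -> `|p| <= 1.
Proof.
move=> ps pp; have [->|p0] := eqVneq p 0; first by rewrite normr0.
have := cstar_norm p; rewrite ps pp => /esym/eqP.
by rewrite -subr_eq0 expr2 -{3}[`|p|]mulr1 -mulrBr mulf_eq0 normr_eq0 (negbTE p0)/= subr_eq0 => /eqP ->.
Qed.

(** A partial isometry suffices: a *-homomorphism sends an identity to a projection, which may be a
    proper one. *)
Lemma norm_le1_isometry u p :
  star p = p -> p ** p = p -> star u ** u = p -> `|u| <= 1.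
Proof.
move=> ps pp uu; have := cstar_norm u; rewrite uu => e.
by rewrite -(@expr_le1 _ 2)// -e norm_projection.
Qed.

Lemma closure_star_subalgebra D : star_subalgebra D -> star_subalgebra (closure D).
Proof.
move=> [D0 DP DM Ds]; split.
- exact: subset_closure.
- move=> c x y /closure_normP Dx /closure_normP Dy; apply/closure_normP => e e0.
  have c0 : 0 < `|c| + 1 by rewrite ltr_wpDl.
  have e2 : 0 < e / 2 by rewrite divr_gt0.
  have [x' Dx' hx] := Dx _ (divr_gt0 e2 c0); have [y' Dy' hy] := Dy _ e2.
  exists (c *: x' + y'); first exact: DP.
  rewrite opprD addrACA -scalerBr (le_lt_trans (ler_normD _ _))// (splitr e) ler_ltD//.
  rewrite normrZ (@le_trans _ _ ((`|c| + 1) * `|x - x'|))//.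
    by rewrite ler_wpM2r// lerDl.
  by rewrite mulrC -ler_pdivlMr// ltW.
- move=> x y Dx Dy.
  apply: (closure_preimage (@smull_continuous x) _ Dy) => z Dz.
  apply: (closure_preimage (@smulr_continuous z) _ Dx) => w Dw.
  exact/subset_closure/DM.
- move=> x; apply: (closure_preimage star_continuous) => y Dy.
  exact/subset_closure/Ds.
Qed.

End cstar_algebra.

(** In the partial order of the complex numbers positive elements are real, so every radius of a
    complex norm reduces to a real one. *)
Lemma cplx_pos (R : realType) (e : Cplx R) : 0 < e -> exists2 r : R, 0 < r & e = r%:C%C.
Proof.
case: e => r i; rewrite ltcE /= => /andP[/eqP -> r0].
by exists r.
Qed.

Lemma cplx_archi (R : realType) (e : Cplx R) : 0 < e -> exists n, n.+1%:R^-1 < e.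
Proof.
move=> /cplx_pos[r r0 ->]; have [n] := ltr_add_invr r0.
rewrite add0r => nr; exists n.
have -> : n.+1%:R^-1 = (n.+1%:R^-1 : R)%:C%C :> Cplx R by rewrite fmorphV rmorph_nat.
by rewrite ltcR.
Qed.

Lemma halving_steps_cvg (R : realType) (V : completeNormedModType (Cplx R))
    (w : nat -> V) : (forall n, `|w n.+1 - w n| <= 2^-1 ^+ n) -> cvgn w.
Proof.
move=> hw; apply/cauchy_cvgP; apply: cauchy_exP => e e0.
(* The right-hand side is the exact value of the geometric sum of the steps from [n] to [n + m]. *)
have tail n m : `|w (n + m)%N - w n| <= 2^-1 ^+ n * (2 - 2 * 2^-1 ^+ m).
  elim: m => [|m IH]; first by rewrite addn0 subrr normr0 expr0 mulr1 subrr mulr0.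
  rewrite (le_trans (ler_distD (w (n + m)%N) _ _))// addnS.
  rewrite (le_trans (lerD (hw _) IH))// exprD [in leRHS]exprS.
  by rewrite -mulrDr mulrA mulfV ?pnatr_eq0// le_eqVlt; apply/orP; left; apply/eqP; field.
have [n nr] := cplx_archi (divr_gt0 e0 (ltr0n _ 2)).
have small : 2^-1 ^+ n.+1 * 2 < e.
  rewrite -ltr_pdivlMr//; apply: le_lt_trans nr.
  rewrite exprVn lef_pV2 ?posrE ?exprn_gt0//.
  by rewrite -natrX ler_nat ltnW// ltn_expl.
exists (w n.+1); exists n.+1 => // k /= nk; rewrite -(subnKC nk).
rewrite -ball_normE /= distrC; apply: le_lt_trans small.
apply: le_trans (tail _ _) _; rewrite ler_wpM2l ?exprn_ge0 ?invr_ge0//.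
by rewrite lerBlDr lerDl mulr_ge0// exprn_ge0// invr_ge0.
Qed.

Lemma cvg_smul (R : realType) (A : cstarAlgType R) I (F : set_system I)
    (FF : Filter F) (u v : I -> A) (x y : A) :
  u @ F --> x -> v @ F --> y -> (fun i => u i ** v i) @ F --> x ** y.
Proof.
move=> ux vy; apply/cvgrPdist_lt => e e0.
have pos (z : A) : 0 < `|z| + 1 by rewrite ltr_wpDl.
have e2 : 0 < e / 2 by rewrite divr_gt0.
move/cvgrPdist_lt: ux => /(_ _ (divr_gt0 e2 (pos y))).
move/cvgrPdist_lt: (vy) => /(_ _ (divr_gt0 e2 (pos x))).
(* Radius 1 only serves to bound [v i] in norm by [|y| + 1]. *)
move/cvgrPdist_lt: vy => /(_ _ ltr01).
apply: filterS3 => i v1 vi ui.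
have -> : x ** y - u i ** v i = x ** (y - v i) + (x - u i) ** v i.
  by rewrite smulBr smulBl addrA subrK.
rewrite (le_lt_trans (ler_normD _ _))// (splitr e) ltrD//.
  rewrite (le_lt_trans (norm_smul _ _))//.
  rewrite (@le_lt_trans _ _ ((`|x| + 1) * `|y - v i|))//.
    by rewrite ler_wpM2r// lerDl.
  by rewrite mulrC -ltr_pdivlMr.
rewrite (le_lt_trans (norm_smul _ _))//.
rewrite (@le_lt_trans _ _ (`|x - u i| * (`|y| + 1)))//.
  rewrite ler_wpM2l// -[v i](subKr y) (le_trans (ler_normB _ _))//.
  by rewrite lerD2l ltW.
by rewrite -ltr_pdivlMr.
Qed.

(* [u = h + iy] satisfies [u^* u = h^2 + y^2 = e], a projection, so [psi u] has
   norm at most 1, and [h] is the real part of [u]. *)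
Lemma star_hom_contraction (R : realType) (A : starAlgType R) (B : cstarAlgType R)
    (psi : A -> B) (e h y : A) : star_hom psi ->
  star e = e -> e ** e = e -> star h = h -> star y = y -> y ** h = h ** y ->
  y ** y = e - h ** h -> `|psi h| <= 1.
Proof.
move=> hpsi es ee hs ys yh yy.
pose u : A := h + 'i *: y.
have us : star u = h - 'i *: y by rewrite starD starZ hs ys conjCi scaleNr.
have uu : star u ** u = e.
  rewrite us /u smulBl !smulDr !smulZl !smulZr yh scalerA -expr2 sqrCi scaleN1r yy.
  by rewrite opprD opprK addrA addrK addrC subrK.
have nu : `|psi u| <= 1.
  apply: (@norm_le1_isometry _ _ _ (psi e)).
  - by rewrite -(star_hom_star hpsi) es.
  - by rewrite -(star_hom_mul hpsi) ee.
  - by rewrite -(star_hom_star hpsi) -(star_hom_mul hpsi) uu.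
have nus : `|psi (star u)| <= 1 by rewrite (star_hom_star hpsi) norm_star.
have -> : h = 2^-1 *: (u + star u).
  by rewrite us /u addrACA subrr addr0 -{2 3}[h]scale1r -scalerDl scalerA mulVf ?scale1r// pnatr_eq0.
rewrite (star_homZ hpsi) (star_homD hpsi) normrZ ger0_norm ?invr_ge0//.
by rewrite mulrC ler_pdivrMr// mul1r (le_trans (ler_normD _ _))// [leRHS]mulr2n lerD.
Qed.

(** * Automatic continuity of *-homomorphisms between C*-algebras *)

Section bounded_star_hom.
Variables (R : realType) (A B : cstarAlgType R) (e : A).
Hypothesis e1 : is_identity e.

Lemma star_identity : star e = e.
Proof.
by rewrite -[LHS](e1 (star e)).1 -{1}[e]starK -starM (e1 (star e)).1 starK.
Qed.

(* [w = 1 - sqrt (1 - h^2)] is the fixed point of [w |-> (h^2 + w^2) / 2], a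
   contraction of the ball of radius 1/2. *)
Lemma selfadjoint_sqrt (h : A) : star h = h -> `|h| <= 2^-1 ->
  exists y, [/\ star y = y, y ** h = h ** y & y ** y = e - h ** h].
Proof.
move=> hs h2; pose f (w : A) := 2^-1 *: (h ** h + w ** w).
pose w n := iter n f 0.
have half0 : (0 : Cplx R) <= 2^-1 by rewrite invr_ge0.
have nhalf : `|2^-1 : Cplx R| = 2^-1 by rewrite ger0_norm.
have sq (x : A) : `|x| <= 2^-1 -> `|x ** x| <= 2^-1 * 2^-1.
  by move=> hx; rewrite (le_trans (norm_smul _ _))// ler_pM.
have w2 n : `|w n| <= 2^-1.
  elim: n => [|n IH]; first by rewrite normr0.
  rewrite /= normrZ nhalf ler_piMr// (le_trans (ler_normD _ _))//.
  rewrite (le_trans (lerD (sq _ h2) (sq _ IH)))// -mulrDl.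
  by rewrite [2^-1 + _](_ : _ = 1) ?mul1r ?invf_le1 ?ler1n//; field.
have step n : `|w n.+1 - w n| <= 2^-1 ^+ n.
  elim: n => [|n IH].
    by rewrite subr0 (le_trans (w2 1))// expr0 invf_le1 ?ler1n.
  rewrite [w n.+2]iterS [w n.+1 in X in _ - X]iterS -!/(w _) -scalerBr normrZ nhalf exprS.
  rewrite ler_wpM2l// opprD addrACA subrr add0r.
  (* This splitting does not use commutativity. Each summand has a factor of norm at most 1/2, so
     together with the outer 1/2 the iteration contracts by 1/2. *)
  have -> : w n.+1 ** w n.+1 - w n ** w n =
      w n.+1 ** (w n.+1 - w n) + (w n.+1 - w n) ** w n.
    by rewrite smulBr smulBl addrA subrK.
  rewrite (le_trans (ler_normD _ _))//.
  have -> : 2^-1 ^+ n = 2^-1 * 2^-1 ^+ n + 2^-1 ^+ n * 2^-1 :> Cplx R by field.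
  by rewrite lerD// (le_trans (norm_smul _ _))// ler_pM.
have wl := halving_steps_cvg step; set l := limn w in wl.
have wS : (fun n => w n.+1) @ \oo --> l by rewrite cvg_shiftS.
have lf : l = f l.
  have fl : (fun n => f (w n)) @ \oo --> f l.
    apply: cvgZ; first exact: cvg_cst.
    by apply: cvgD; [exact: cvg_cst | exact: cvg_smul].
  exact: (cvg_unique _ wS fl).
have ws n : star (w n) = w n.
  elim: n => [|n IH]; first exact: star0.
  by rewrite /= starZ starD !starM hs IH conj_Creal// ?ger0_real.
have wh n : w n ** h = h ** w n.
  elim: n => [|n IH]; first by rewrite smul0r smulr0.
  rewrite /= smulZl smulZr smulDl smulDr -!smulA; congr (_ *: (_ + _)).
  by rewrite IH !smulA IH.
have ls : star l = l.
  have lw : (fun n => star (w n)) @ \oo --> star l.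
    exact: (cvg_comp _ _ wl (@star_continuous _ _ l)).
  rewrite (funext ws : (fun n => star (w n)) = w) in lw.
  exact: (cvg_unique _ lw wl).
have lh : l ** h = h ** l.
  have lh1 : (fun n => w n ** h) @ \oo --> l ** h by apply: cvg_smul => //; exact: cvg_cst.
  rewrite (funext wh : (fun n => w n ** h) = (fun n => h ** w n)) in lh1.
  have hl1 : (fun n => h ** w n) @ \oo --> h ** l by apply: cvg_smul => //; exact: cvg_cst.
  exact: (cvg_unique _ lh1 hl1).
exists (e - l); split.
- by rewrite starB star_identity ls.
- by rewrite smulBl smulBr lh !(e1 h).1 !(e1 h).2.
- rewrite smulBl !smulBr (e1 l).1 (e1 l).2 (e1 e).1.
  (* The fixed-point equation for [l]; it turns [(e - l)^2 = e - 2l + l^2] into [e - h^2]. *)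
  have : l + l = h ** h + l ** l.
    have half : 2^-1 + 2^-1 = 1 :> Cplx R by field.
    by rewrite {1 2}lf /f -scalerDl half scale1r.
  by move=> ll; rewrite opprB addrA addrAC -[e - l - l]addrA -opprD ll opprD addrA subrK.
Qed.

(** A self-adjoint element is scaled to norm 1/2, where [selfadjoint_sqrt] and
    [star_hom_contraction] apply; this yields the constant 2. The general case follows by applying
    this to [star x ** x] and using the C*-identity. *)
Lemma star_hom_bounded (psi : A -> B) x : star_hom psi -> `|psi x| <= 2 * `|x|.
Proof.
move=> hpsi.
have sa h : star h = h -> `|psi h| <= 2 * `|h|.
  move=> hs; have [->|h0] := eqVneq h 0.
    by rewrite star_hom0// !normr0 mulr0.
  have c0 : 0 < 2 * `|h| by rewrite mulr_gt0// normr_gt0.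
  pose c : Cplx R := (2 * `|h|)^-1.
  have cs : star (c *: h) = c *: h.
    by rewrite starZ hs conj_Creal// ger0_real// invr_ge0 ltW.
  have nc : `|c| = c by rewrite ger0_norm// invr_ge0 ltW.
  have [|y [ys yh yy]] := selfadjoint_sqrt cs.
    by rewrite normrZ nc /c invfM -mulrA mulVf ?mulr1// normr_eq0.
  have := star_hom_contraction hpsi star_identity (e1 e).1 cs ys yh yy.
  by rewrite (star_homZ hpsi) normrZ nc mulrC ler_pdivrMr// mul1r.
rewrite -(@ler_pXn2r _ 2 isT)// ?nnegrE ?mulr_ge0// -cstar_norm.
rewrite -(star_hom_star hpsi) -(star_hom_mul hpsi) (le_trans (sa _ _))//.
  by rewrite starM starK.
by rewrite cstar_norm exprMn ler_wpM2r ?exprn_ge0// expr2 ler_pMr// ler1n.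
Qed.

Lemma star_hom_continuous (psi : A -> B) : star_hom psi -> continuous psi.
Proof.
move=> hpsi; apply: (@bounded_additive_continuous (Cplx R) A B _ 2) => //.
  exact: star_homB.
by move=> x; exact: star_hom_bounded.
Qed.

End bounded_star_hom.

(** * Trigonometric polynomials are dense *)

Section roots_of_unity.
Variable C : numClosedFieldType.

(** [X^n - 1] is separable in characteristic 0, so it has [n] distinct roots, and a group of [n]
    distinct [n]-th roots of unity has a generator. *)
Lemma primitive_root_exists n : (0 < n)%N -> exists z : C, n.-primitive_root z.
Proof.
move=> n0; have [s hs] := closed_field_poly_normal ('X^n - 1 : {poly C}).
move: hs; rewrite (monicP (monicXnsubC 1 n0)) scale1r => hs.
have /hasP[z _ hz] : has n.-primitive_root s; last by exists z.
apply: has_prim_root => //.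
- by apply/allP => z zs; rewrite /root_of_unity hs root_prod_XsubC.
- rewrite -separable_prod_XsubC -hs; apply: separable_Xn_sub_1.
  by rewrite pnatr_eq0 -lt0n.
- by have := size_XnsubC (1 : C) n0; rewrite hs size_prod_XsubC => -[->].
Qed.

(** Orthogonality of characters of a cyclic group. It underlies the kernel sums, the sums over
    fibres, the frame and the gauge average. *)
Lemma sum_powers_root (n : nat) (u : C) :
  u ^+ n = 1 -> \sum_(i < n) u ^+ i = if u == 1 then n%:R else 0.
Proof.
move=> un; case: eqVneq => [->|u1].
  by under eq_bigr do rewrite expr1n; rewrite sumr_const card_ord.
apply/eqP; have /eqP := subrX1 u n.
by rewrite un subrr eq_sym mulf_eq0 subr_eq0 (negbTE u1).
Qed.

(* The kernel |1 + u|^(2n) on the unit circle. *)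
Definition kern n (u : C) := ((1 + u) * (1 + u^-1)) ^+ n.

(** The kernel is a Laurent polynomial with exponents [k - n] between [-n] and [n]. Summing over the
    [m]-th roots of unity keeps exponents divisible by [m]; as [n < m], only the constant term
    survives. *)
Lemma kern_sum m n (w z : C) : (n < m)%N -> m.-primitive_root w -> z != 0 ->
  \sum_(i < m) kern n (z * w ^+ i) = (m * 'C(n.*2, n))%:R.
Proof.
move=> nm wm z0; have w0 : w != 0 by rewrite (prim_root_eq0 wm) -lt0n (leq_ltn_trans _ nm).
have kernE u : u != 0 ->
    kern n u = \sum_(k < n.*2.+1) ('C(n.*2, k))%:R * (u ^+ k / u ^+ n).
  move=> u0; rewrite /kern.
  have -> : (1 + u) * (1 + u^-1) = (1 + u) ^+ 2 / u by field.
  rewrite expr_div_n -exprM mul2n exprDn mulr_suml.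
  by apply: eq_bigr => k _; rewrite expr1n mul1r -mulr_natl mulrA.
under eq_bigr do rewrite kernE ?mulf_neq0 ?expf_neq0//.
rewrite exchange_big/=.
have powE (i k : nat) : (z * w ^+ i) ^+ k / (z * w ^+ i) ^+ n =
    z ^+ k / z ^+ n * (w ^+ k / w ^+ n) ^+ i.
  by rewrite !exprMn exprVn -!exprM [(k * i)%N]mulnC [(n * i)%N]mulnC invfM mulrACA.
under eq_bigr => k _.
  rewrite -mulr_sumr.
  under eq_bigr do rewrite powE.
  rewrite -mulr_sumr sum_powers_root; last first.
    by rewrite exprMn exprVn -!exprM ![(_ * m)%N]mulnC !exprM (prim_expr_order wm) !expr1n invr1 mulr1.
  over.
have kn : (n < n.*2.+1)%N by lia.
rewrite (bigD1 (Ordinal kn))//= big1 ?addr0 => [|k kn'].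
  by rewrite !mulfV ?expf_neq0// eqxx mul1r natrM mulrC.
rewrite ifF ?mulr0//; apply/negP => /eqP e1.
have : w ^+ k = w ^+ n by rewrite -[RHS]mul1r -e1 divfK ?expf_neq0.
move/eqP; rewrite (eq_prim_root_expr wm) => /eqP e2.
have {kn'} : (k : nat) != n by apply: contra kn' => /eqP h; apply/eqP/val_inj.
have := ltn_ord k; move: e2; rewrite [in RHS]modn_small//.
have [km|km] := ltnP k m; first by rewrite modn_small// => -> _ /eqP.
(* Here [k mod m] is [k - m], and [k - m < n] because [k <= 2n] and [n < m]. *)
rewrite -(subnK km) modnDr modn_small; last by have := ltn_ord k; lia.
by lia.
Qed.

Lemma kern_ge0 n (u : C) : `|u| = 1 -> 0 <= kern n u.
Proof.
move=> u1; rewrite /kern exprn_ge0//.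
have -> : 1 + u^-1 = (1 + u)^*.
  by rewrite rmorphD rmorph1 invC_norm u1 expr1n invr1 mul1r.
exact: mul_conjC_ge0.
Qed.

(** The parallelogram identity [|1 - u|^2 + |1 + u|^2 = 4] on the unit circle, multiplied by the
    kernel. *)
Lemma kern_dist n (u : C) : `|u| = 1 ->
  `|1 - u| ^+ 2 * kern n u = 4 * kern n u - kern n.+1 u.
Proof.
move=> u1; have u0 : u != 0 by rewrite -normr_eq0 u1 oner_eq0.
have -> : `|1 - u| ^+ 2 = (1 - u) * (1 - u^-1).
  by rewrite normCK rmorphB rmorph1 [u^-1]invC_norm u1 expr1n invr1 mul1r.
by rewrite /kern exprS -mulrBl; congr (_ * _); field.
Qed.

(** By [kern_dist] the second moment is [4 C(2n,n) - C(2n+2,n+1)] up to the factor [m]. Its ratio to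
    the total mass, [2/(n+1)], tends to 0, which is the Korovkin condition. The kernel peaks at
    1. *)
Lemma kern_dist_sum m n (w z : C) : (n.+1 < m)%N -> m.-primitive_root w -> `|z| = 1 ->
  \sum_(i < m) `|1 - z * w ^+ i| ^+ 2 * kern n (z * w ^+ i) =
  (m * 'C(n.*2, n))%:R * (2 / n.+1%:R).
Proof.
move=> nm wm z1; have z0 : z != 0 by rewrite -normr_eq0 z1 oner_eq0.
have w1 : `|w| = 1.
  apply/eqP; rewrite -(@pexpr_eq1 _ _ m) ?(leq_ltn_trans _ nm)//.
  by rewrite -normrX (prim_expr_order wm) normr1.
under eq_bigr do rewrite kern_dist ?normrM ?normrX ?z1 ?w1 ?expr1n ?mul1r//.
rewrite sumrB -mulr_sumr !kern_sum// ?(ltnW nm)// !natrM.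
have e : (n.+1 * 'C(n.+1.*2, n.+1) = 2 * n.*2.+1 * 'C(n.*2, n))%N.
  have h1 := mul_bin_diag n.*2.+2 n; have h2 := mul_bin_diag n.*2.+1 n.
  have h3 : 'C(n.*2.+1, n.+1) = 'C(n.*2.+1, n).
    by rewrite -bin_sub; [congr 'C(_, _); lia | lia].
  by rewrite doubleS -h1 -mulnA h2 /= h3; lia.
have n0 : n.+1%:R != 0 :> C by rewrite pnatr_eq0.
have -> : ('C(n.+1.*2, n.+1))%:R = 2 * (n.*2.+1)%:R * ('C(n.*2, n))%:R / n.+1%:R :> C.
  by apply: (mulIf n0); rewrite divfK// -!natrM mulnC e.
rewrite -!natr1 -mul2n natrM; move: n0; rewrite -natr1 => n0.
by field.
Qed.

End roots_of_unity.

(** * Compactness of the torus *)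

Section torus_topology.
Variables (R : realType) (d : nat).
Local Notation C := (Cplx R).
Local Notation TT := (torus R d).

Lemma norm_real_complex (r : R) : `|r%:C%C : C| = `|r|%:C%C.
Proof. by rewrite normc_def /= expr0n /= addr0 sqrtr_sqr. Qed.

Lemma cexp_continuous : continuous (@cexp R).
Proof.
move=> s; apply/cvgrPdist_lt => e /cplx_pos[r r0 ->].
have r2 : 0 < r / 2 by rewrite divr_gt0.
have /cvgrPdist_lt/(_ _ r2) := @continuous_cos R s.
have /cvgrPdist_lt/(_ _ r2) := @continuous_sin R s.
apply: filterS2 => t st ct.
have -> : cexp s - cexp t = (cos s - cos t)%:C%C + 'i * (sin s - sin t)%:C%C.
  by rewrite [LHS]complexE.
rewrite (le_lt_trans (ler_normD _ _))// normrM normCi mul1r !norm_real_complex.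
by rewrite -rmorphD ltcR (splitr r) ltrD.
Qed.

(** [acos] covers the upper half circle and its negative the lower one; the bounded range of [s]
    makes the torus the image of a compact cube. *)
Lemma cexp_surjective (z : C) : `|z| = 1 ->
  exists2 s : R, -1 <= s <= 1 & z = cexp (2 * pi * s).
Proof.
case: z => x y z1.
have xy : x ^+ 2 + y ^+ 2 = 1.
  have /(congr1 (fun u => u ^+ 2)) := z1; rewrite normc_def /= -rmorphXn /= expr1n.
  by rewrite sqr_sqrtr ?addr_ge0 ?sqr_ge0// => -[].
have x1 : -1 <= x <= 1.
  rewrite -ler_norml -sqrtr_sqr -[leRHS]sqrtr1 ler_sqrt//.
  by rewrite -xy lerDl sqr_ge0.
have pi0 : 0 < 2 * pi :> R by rewrite mulr_gt0// pi_gt0.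
have /andP[t0 tpi] : 0 <= acos x <= pi by rewrite acos_ge0// acos_lepi.
have bound : 0 <= acos x / (2 * pi) <= 1.
  apply/andP; split; first by rewrite divr_ge0// ltW.
  rewrite ler_pdivrMr// mul1r (le_trans tpi)//.
  by rewrite ler_peMl ?ler1n// pi_ge0.
have sinE : sin (acos x) = `|y|.
  by rewrite sin_acos// -sqrtr_sqr; congr Num.sqrt; rewrite -xy addrC addKr.
have cosE : cos (acos x) = x by rewrite acosK// in_itv.
have eq0 : 2 * pi * (acos x / (2 * pi)) = acos x by rewrite mulrC divfK// gt_eqF.
have [y0|y0] := leP 0 y.
  exists (acos x / (2 * pi)).
    by case/andP: bound => b0 b1; rewrite b1 (le_trans _ b0)// lerN10.
  by rewrite eq0 /cexp cosE sinE ger0_norm.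
exists (- (acos x / (2 * pi))).
  by case/andP: bound => b0 b1; rewrite lerN2 b1 /= (le_trans _ ler01)// oppr_le0.
by rewrite mulrN eq0 /cexp cosN sinN cosE sinE ltr0_norm// opprK.
Qed.

Lemma torus_exp_continuous : continuous (@torus_exp R d).
Proof.
move=> t; apply: (@cvg_torus R d _ (nbhs t) (nbhs_filter t)) => j.
have -> : (fun x => val (torus_exp x) 0 j) = @cexp R \o (fun x : 'rV[R]_d => 2 * pi * x 0 j).
  by apply/funext => x; rewrite /= mxE.
rewrite [X in _ --> X]mxE; apply: continuous_comp; last exact: cexp_continuous.
apply: cvgMl_tmp; [exact: (nbhs_filter t) | exact: (@coord_continuous R 1 d 0 j t)].
Qed.

Lemma torus_compact : compact [set: TT].
Proof.
have -> : [set: TT] = @torus_exp R d @` [set t : 'rV[R]_d | forall j, `[(-1), 1]%classic (t ord0 j)].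
  apply/seteqP; split => // z _.
  have /choice[s hs] : forall j, exists s : R, -1 <= s <= 1 /\ val z 0 j = cexp (2 * pi * s).
    by move=> j; have [s] := cexp_surjective (torus_norm z j); exists s.
  exists (\row_j s j).
    by move=> j /=; rewrite mxE in_itv /=; exact: (hs j).1.
  by apply: torus_ext => j; rewrite /= !mxE -(hs j).2.
apply: continuous_compact; last first.
  apply: (@rV_compact R d (fun=> `[(-1), 1]%classic)) => _; exact: segment_compact.
by apply: continuous_subspaceT; exact: torus_exp_continuous.
Qed.

End torus_topology.

(** * Korovkin approximation on the torus *)

Section trigonometric_density.
Variables (R : realType) (d : nat).
Local Notation C := (Cplx R).
Local Notation TT := (torus R d).
Local Notation A := (continuousType TT C).

(** The Korovkin test function: squared distances are used because the kernel has an explicit second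
    moment. *)
Definition sqdist (z w : TT) : C := \sum_(j < d) `|val z 0 j - val w 0 j| ^+ 2.

Lemma sqdist_ge0 z w : 0 <= sqdist z w.
Proof. by apply: sumr_ge0 => j _; rewrite exprn_ge0. Qed.

Lemma sqdist_eq0 z w : sqdist z w = 0 -> z = w.
Proof.
move=> h; apply: torus_ext => j; apply/eqP; rewrite -subr_eq0 -normr_eq0.
have /psumr_eq0P/(_ h j isT)/eqP : forall j, true -> 0 <= `|val z 0 j - val w 0 j| ^+ 2.
  by move=> k _; rewrite exprn_ge0.
by rewrite expf_eq0.
Qed.

Lemma sqdist_continuous : continuous (fun p : TT * TT => sqdist p.1 p.2).
Proof.
move=> p; apply: cvg_sumC => j.
have h : (fun q : TT * TT => `|val q.1 0 j - val q.2 0 j|) @ nbhs p --> `|val p.1 0 j - val p.2 0 j|.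
  apply: cvg_norm; apply: cvgB; apply: cvg_torus_coord; [exact: cvg_fst|exact: cvg_snd].
by rewrite expr2; under eq_cvg do rewrite expr2; exact: cvgM.
Qed.

(** Near the diagonal continuity gives the bound [e]; away from it [sqdist] is locally bounded below
    and a large [K] absorbs the values of [f]. Compactness of the square of the torus makes [K]
    uniform. *)
Lemma quadratic_modulus (f : A) (e : C) : 0 < e ->
  exists K : nat, forall z w, `|f z - f w| <= e + K%:R * sqdist z w.
Proof.
move=> e0; pose P (n : nat) (p : TT * TT) := `|f p.1 - f p.2| <= e + n%:R * sqdist p.1 p.2.
have fc (p : TT * TT) : (fun q : TT * TT => f q.1 - f q.2) @ nbhs p --> f p.1 - f p.2.
  apply: cvgB; [exact: (cvg_comp _ _ (@cvg_fst _ _ (nbhs p.1) (nbhs p.2) _) (@cts_fun _ _ f p.1))|].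
  exact: (cvg_comp _ _ (@cvg_snd _ _ (nbhs p.1) (nbhs p.2) _) (@cts_fun _ _ f p.2)).
have : \forall n \near \oo, setT `*` setT `<=` P n.
  apply: (compact_near_coveringP _).1.
    by apply: compact_setX; exact: torus_compact.
  move=> p _; have [D0|D0] := eqVneq (sqdist p.1 p.2) 0.
    have p12 := sqdist_eq0 D0.
    exists ([set q | `|f q.1 - f q.2| < e], setT).
      split; last exact: filterT.
      have /cvgrPdist_lt/(_ _ e0) := fc p; rewrite p12 subrr.
      by apply: filterS => q /=; rewrite sub0r normrN.
    move=> [q n] [/= hq _]; rewrite /P (le_trans (ltW hq))// lerDl.
    by rewrite mulr_ge0// sqdist_ge0.
  have Dp : 0 < sqdist p.1 p.2 by rewrite lt_def D0 sqdist_ge0.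
  have D2 : 0 < sqdist p.1 p.2 / 2 by rewrite divr_gt0.
  pose M := `|f p.1 - f p.2| + 1.
  have M0 : 0 < M by rewrite ltr_wpDl.
  (* [n0.+1] times half of the distance at [p] exceeds [M], which bounds the difference of values of
     [f] near [p]. *)
  have [n0 hn0] := cplx_archi (divr_gt0 D2 M0).
  exists ([set q | `|f q.1 - f q.2| <= M /\ sqdist p.1 p.2 / 2 <= sqdist q.1 q.2],
    [set n | (n0.+1 <= n)%N]); [split|] => /=.
  - have /cvgrPdist_lt/(_ _ ltr01) := fc p.
    have /cvgrPdist_lt/(_ _ D2) := @sqdist_continuous p.
    apply: filterS2 => q h1 h2; split.
      rewrite -[f q.1 - _](subKr (f p.1 - f p.2)) (le_trans (ler_normB _ _))//.
      by rewrite lerD2l ltW.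
    have := le_lt_trans (real_ler_norm _) h1.
    rewrite realB ?ger0_real ?sqdist_ge0// => /(_ isT) /ltW.
    by rewrite lerBlDr addrC -lerBlDr {1}[sqdist p.1 p.2](splitr _) addrK.
  - by exists n0.+1.
  - move=> [q n] [/= [h1 h2] hn]; rewrite /P (le_trans h1)// (@le_trans _ _ (n%:R * sqdist q.1 q.2))//.
      rewrite ltr_pdivlMr// mulrC ltr_pdivrMr// in hn0.
      rewrite (le_trans (ltW hn0))// mulrC ler_pM ?ler_nat// ltW//.
    by rewrite lerDr ltW.
by move=> [n _ /(_ n (leqnn n)) h]; exists n => z w; exact: (h (z, w)).
Qed.

Section density.
Variable D : set A.
Hypotheses (hD : star_subalgebra D) (D1 : D cf1) (DU : forall j, D (torus_coord R j)).

(** A predicate on bare functions, so that membership in [D] can be read off from the shape of a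
    formula without packaging each subterm as a continuous function. *)
Definition represented (phi : TT -> C) := exists2 g : A, D g & forall z, g z = phi z.

Lemma represented_cst c : represented (fun=> c).
Proof.
exists (c *: cf1 + 0).
  by apply: (star_subalgebraP hD) => //; exact: (star_subalgebra0 hD).
by move=> z; rewrite addr0; exact: mulr1.
Qed.

Lemma representedD phi psi :
  represented phi -> represented psi -> represented (fun z => phi z + psi z).
Proof.
move=> [g Dg gE] [h Dh hE]; exists (1 *: g + h).
  exact: (star_subalgebraP hD).
by move=> z; rewrite scale1r -gE -hE.
Qed.

Lemma representedM phi psi :
  represented phi -> represented psi -> represented (fun z => phi z * psi z).
Proof.
move=> [g Dg gE] [h Dh hE]; exists (g ** h).
  exact: (star_subalgebraM hD).
by move=> z; rewrite -gE -hE.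
Qed.

Lemma represented_coord j : represented (fun z => val z 0 j).
Proof. by exists (torus_coord R j). Qed.

Lemma represented_coordV j : represented (fun z => (val z 0 j)^-1).
Proof.
exists (star (torus_coord R j)); first exact: (star_subalgebra_star hD).
by move=> z; rewrite [RHS]invC_norm torus_norm expr1n invr1 mul1r.
Qed.

Lemma represented_sum I (r : seq I) (phi : I -> TT -> C) :
  (forall i, represented (phi i)) -> represented (fun z => \sum_(i <- r) phi i z).
Proof.
move=> h; elim: r => [|i r IH].
  by under eq_fun do rewrite big_nil; exact: represented_cst.
by under eq_fun do rewrite big_cons; exact: representedD.
Qed.

Lemma represented_prod I (r : seq I) (phi : I -> TT -> C) :
  (forall i, represented (phi i)) -> represented (fun z => \prod_(i <- r) phi i z).
Proof.
move=> h; elim: r => [|i r IH].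
  by under eq_fun do rewrite big_nil; exact: represented_cst.
by under eq_fun do rewrite big_cons; exact: representedM.
Qed.

Lemma represented_exp phi n : represented phi -> represented (fun z => phi z ^+ n).
Proof.
move=> h; elim: n => [|n IH]; first exact: represented_cst.
by under eq_fun do rewrite exprS; exact: representedM.
Qed.

(** The approximant averages the samples [f (smp i)] with the nonnegative weights [W i z / c ^+ d],
    whose sum is 1. By [quadratic_modulus] the error is at most [e/2] plus [K] times the second
    moment [2d/(n+1)]. *)
Lemma trigonometric_density (f : A) (e : C) : 0 < e ->
  exists2 g : A, D g & forall z, `|f z - g z| <= e.
Proof.
move=> e0; have e2 : 0 < e / 2 by rewrite divr_gt0.
have [K hK] := quadratic_modulus f e2.
(* The successor keeps the divisor positive when [K * d] is 0; [n] is then chosen so that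
   [2Kd/(n+1) <= e/2]. *)
have Kd0 : 0 < (K * d).+1%:R * 2 :> C by rewrite mulr_gt0.
have [n hn] := cplx_archi (divr_gt0 e2 Kd0).
(* The least [m] with [n.+1 < m], as [kern_dist_sum] requires. *)
pose m := n.+2; have [w wm] := @primitive_root_exists C m isT.
have w1 : `|w| = 1.
  by apply/eqP; rewrite -(@pexpr_eq1 _ _ m)// -normrX (prim_expr_order wm) normr1.
have w0 : w != 0 by rewrite -normr_eq0 w1 oner_eq0.
have smpP (i : {ffun 'I_d -> 'I_m}) :
    (\row_j (w ^+ i j)^-1) \in [set z : 'rV[C]_d | forall j, `|z 0 j| = 1].
  by rewrite inE => j; rewrite mxE normfV normrX w1 expr1n invr1.
pose smp i : TT := SigSub (smpP i).
pose W (i : {ffun 'I_d -> 'I_m}) (z : TT) : C := \prod_(j < d) kern n (val z 0 j * w ^+ i j).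
pose c : C := (m * 'C(n.*2, n))%:R.
have c0 : 0 < c by rewrite ltr0n muln_gt0 bin_gt0 -addnn leq_addr.
have W0 i z : 0 <= W i z.
  by apply: prodr_ge0 => j _; rewrite kern_ge0// normrM normrX torus_norm w1 expr1n mulr1.
have sumW z : \sum_i W i z = c ^+ d.
  rewrite /W -(bigA_distr_bigA (fun (j : 'I_d) (i : 'I_m) => kern n (val z 0 j * w ^+ i))).
  rewrite (eq_bigr (fun=> c)) ?prodr_const ?card_ord// => j _.
  by rewrite kern_sum// torus_neq0.
have sumWd z l : \sum_i W i z * `|val z 0 l - val (smp i) 0 l| ^+ 2 = c ^+ d * (2 / n.+1%:R).
  (* The squared distance is put into the factor of index [l], so that the sum over sample points
     still factors over the coordinates. *)
  pose g (j : 'I_d) (i : 'I_m) : C :=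
    (if j == l then `|1 - val z 0 j * w ^+ i| ^+ 2 else 1) * kern n (val z 0 j * w ^+ i).
  transitivity (\sum_(i : {ffun 'I_d -> 'I_m}) \prod_j g j (i j)).
    apply: eq_bigr => i _; rewrite /g big_split /= mulrC; congr (_ * _).
    rewrite (bigD1 l)//= eqxx big1 ?mulr1 => [|j /negbTE ->]//; congr (_ ^+ 2).
    rewrite mxE -[LHS]mulr1 -[X in _ * X](_ : `|w ^+ i l| = 1); last by rewrite normrX w1 expr1n.
    by rewrite -normrM mulrBl mulVf ?expf_neq0// distrC.
  rewrite -(bigA_distr_bigA g) (bigD1 l)//=.
  have -> : \prod_(j < d | j != l) \sum_(i < m) g j i = c ^+ d.-1.
    have -> : c ^+ d.-1 = \prod_(j < d | j != l) c by rewrite prodr_const cardC1 card_ord.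
    apply: eq_bigr => j /negbTE jl; rewrite /g jl.
    by under eq_bigr do rewrite mul1r; rewrite kern_sum// torus_neq0.
  rewrite /g eqxx kern_dist_sum ?torus_norm// mulrAC -exprS prednK//.
  by apply: leq_trans (ltn_ord l).
have [g Dg gE] : represented (fun z => (c ^+ d)^-1 * \sum_(i : {ffun 'I_d -> 'I_m}) f (smp i) * W i z).
  apply: representedM; first exact: represented_cst.
  apply: represented_sum => i; apply: representedM; first exact: represented_cst.
  apply: represented_prod => j; apply: represented_exp; apply: representedM.
    apply: representedD; first exact: represented_cst.
    by apply: representedM; [exact: represented_coord | exact: represented_cst].
  apply: representedD; first exact: represented_cst.
  under eq_fun do rewrite invfM.
  by apply: representedM; [exact: represented_coordV | exact: represented_cst].
exists g => // z; rewrite gE.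
have cd0 : 0 < c ^+ d by rewrite exprn_gt0.
have -> : f z - (c ^+ d)^-1 * (\sum_i f (smp i) * W i z) =
    (c ^+ d)^-1 * \sum_i (f z - f (smp i)) * W i z.
  under [in RHS]eq_bigr do rewrite mulrBl.
  by rewrite sumrB mulrBr -mulr_sumr sumW mulrCA mulVf ?mulr1// gt_eqF.
have cdi : 0 <= (c ^+ d)^-1 by rewrite invr_ge0 ltW.
rewrite normrM (ger0_norm cdi) ler_pdivrMl//.
rewrite (le_trans (ler_norm_sum _ _ _))//.
apply: (@le_trans _ _ (\sum_i (e / 2 + K%:R * sqdist z (smp i)) * W i z)).
  by apply: ler_sum => i _; rewrite normrM (ger0_norm (W0 _ _)) ler_wpM2r.
under eq_bigr do rewrite mulrDl.
rewrite big_split /= -mulr_sumr sumW.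
have -> : \sum_i K%:R * sqdist z (smp i) * W i z = K%:R * (d%:R * (c ^+ d * (2 / n.+1%:R))).
  under eq_bigr do rewrite -mulrA.
  rewrite -mulr_sumr; congr (_ * _).
  under eq_bigr do rewrite mulrC /sqdist mulr_sumr.
  rewrite exchange_big /=; under eq_bigr do rewrite sumWd.
  by rewrite sumr_const card_ord [RHS]mulr_natl.
have key : K%:R * d%:R * (2 / n.+1%:R) <= e / 2.
  rewrite ltr_pdivlMr// in hn; apply: le_trans (ltW hn).
  have -> : K%:R * d%:R * (2 / n.+1%:R) = n.+1%:R^-1 * ((K * d)%:R * 2) :> C.
    by rewrite natrM [RHS]mulrC !mulrA.
  by rewrite ler_wpM2l ?invr_ge0// ler_wpM2r// ler_nat.
have -> : e / 2 * c ^+ d + K%:R * (d%:R * (c ^+ d * (2 / n.+1%:R))) =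
    c ^+ d * (e / 2 + K%:R * d%:R * (2 / n.+1%:R)) by ring.
apply: ler_wpM2l; first exact: ltW.
by rewrite [leRHS](splitr e) lerD2l.
Qed.

End density.
End trigonometric_density.

(** * Fibres of sigma_F and the relations between U and S *)

Section monomials.
Variables (R : realType) (d : nat).
Local Notation C := (Cplx R).
Local Notation TT := (torus R d).
Implicit Types (mu nu : 'rV[int]_d) (z : TT).

Lemma monomial_continuous nu : continuous (fun z : TT => \prod_(j < d) val z 0 j ^ nu 0 j).
Proof.
move=> z; apply: (@cvg_prodC R _ (nbhs z) (nbhs_filter z)) => j.
apply: (@cvg_exprz R _ (nbhs z) (nbhs_filter z)); first exact: torus_neq0.
exact: torus_coord_cts.
Qed.

Definition monomial nu : continuousType TT C := mkcts (@monomial_continuous nu).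

Lemma monomialE nu z : monomial nu z = \prod_(j < d) val z 0 j ^ nu 0 j.
Proof. by []. Qed.

Lemma monomialD mu nu z : monomial (mu + nu) z = monomial mu z * monomial nu z.
Proof.
rewrite !monomialE -big_split; apply: eq_bigr => j _.
by rewrite mxE expfzDr// torus_neq0.
Qed.

Lemma monomial0 z : monomial 0 z = 1.
Proof. by rewrite monomialE big1// => j _; rewrite mxE expr0z. Qed.

Lemma norm_monomial nu z : `|monomial nu z| = 1.
Proof.
rewrite monomialE normr_prod big1// => j _.
by case: (nu 0 j) => n; rewrite ?normfV normrX torus_norm expr1n ?invr1.
Qed.

Lemma monomial_conj nu z : (monomial nu z)^* = monomial (- nu) z.
Proof.
have nz : monomial nu z != 0 by rewrite -normr_eq0 norm_monomial oner_eq0.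
apply: (mulfI nz); rewrite -normCK norm_monomial expr1n.
by rewrite -monomialD subrr monomial0.
Qed.

End monomials.

Section fibres.
Variables (R : realType) (d : nat) (a : 'rV[int]_d) (G : 'M[int]_d).
Hypothesis a_gt0 : forall j, 0 < a 0 j.
Local Notation C := (Cplx R).
Local Notation TT := (torus R d).
Local Notation OM := (Omega R (diag_mx a) G).
Local Notation N j := `|a 0%R j|%N.

Lemma index_size_gt0 j : (0 < N j)%N.
Proof. by have := a_gt0 j; lia. Qed.

Lemma det_diag_neq0 : \det (diag_mx a) != 0.
Proof. by rewrite det_diag; apply/prodf_neq0 => j _; rewrite gt_eqF. Qed.

Lemma absz_det_diag : `|\det (diag_mx a)|%N = (\prod_(j < d) N j)%N.
Proof. by rewrite det_diag (big_morph _ abszM (erefl `|1|%N)). Qed.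

(* I(F) is encoded as [family digit], the functions into one common ordinal that
   satisfy [i j < a_j], because [bigA_distr_big_dep] needs a non-dependent
   codomain. *)
Definition digit_bound := (\sum_(j < d) N j)%N.

Definition digit (j : 'I_d) : pred 'I_digit_bound := fun i => (i < N j)%N.

Lemma index_size_le j : (N j <= digit_bound)%N.
Proof. by rewrite /digit_bound (bigD1 j)//= leq_addr. Qed.

Lemma sum_digits (f : 'I_d -> nat -> C) :
  \sum_(i in family digit) \prod_(j < d) f j (i j) = \prod_(j < d) \sum_(i < N j) f j i.
Proof.
rewrite -(bigA_distr_big_dep digit (fun j i => f j (val i))).
apply: eq_bigr => j _; rewrite (big_ord_widen _ (f j) (index_size_le j)).
by apply: eq_bigl.
Qed.

Lemma torus_endo_diagE (z : TT) j : val (torus_endo (diag_mx a) z) 0 j = val z 0 j ^+ N j.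
Proof.
rewrite torus_endoE (bigD1 j)//= big1 ?mulr1 => [|k kj].
  by rewrite mxE eqxx mulr1n; have := a_gt0 j; case: (a 0 j).
by rewrite mxE eq_sym (negbTE kj) mulr0n expr0z.
Qed.

(** The fibre is a coset of the kernel of [torus_endo (diag_mx a)]: one preimage [y], translated in
    each coordinate by the [a_j]-th roots of unity. [phi] is defined on bare row vectors so that the
    translates need no proof of lying on the torus. *)
Lemma fibre_param (x : TT) : exists (y : TT) (w : 'I_d -> C),
  (forall j, (N j).-primitive_root (w j)) /\
  forall phi : 'rV[C]_d -> C,
    \sum_(p \in [set p : OM | (val p).1 = x]) phi (val (val (p : OM)).2) =
    \sum_(i in family digit) phi (\row_j (val y 0 j * w j ^+ i j)).
Proof.
have [s [sK _]] := torus_section_exists R det_diag_neq0.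
pose y := s (torus_endo G x).
have [w hw] := choice (fun j => @primitive_root_exists C _ (index_size_gt0 j)).
exists y, w; split=> // phi.
have w1 j : `|w j| = 1.
  apply/eqP; rewrite -(@pexpr_eq1 _ _ (N j)) ?index_size_gt0//.
  by rewrite -normrX (prim_expr_order (hw j)) normr1.
have rowP (i : {ffun 'I_d -> 'I_digit_bound}) : (\row_j (val y 0 j * w j ^+ i j))
    \in [set z : 'rV[C]_d | forall j, `|z 0 j| = 1].
  by rewrite inE => j; rewrite mxE normrM torus_norm normrX w1 expr1n mulr1.
pose pt i : TT := SigSub (rowP i).
have ptP i : (x, pt i) \in [set p : TT * TT | torus_endo (diag_mx a) p.2 = torus_endo G p.1].
  rewrite inE /= -[RHS]sK; apply: torus_ext => j; rewrite !torus_endo_diagE mxE exprMn.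
  by rewrite -exprM mulnC exprM (prim_expr_order (hw j)) expr1n mulr1.
pose h i : OM := SigSub (ptP i).
have hbij : set_bij [set` enum (family digit)] [set p : OM | (val p).1 = x] h.
  split=> [i _ //|i k|p /= px].
    rewrite !inE /= !mem_enum => /familyP di /familyP dk e.
    apply/ffunP => j; apply/val_inj.
    have e2 : val y 0 j * w j ^+ i j = val y 0 j * w j ^+ k j.
      by have := congr1 (fun p : OM => val (val p).2 0 j) e; rewrite /= !mxE.
    move/(mulfI (torus_neq0 y j))/eqP: e2; rewrite (eq_prim_root_expr (hw j)).
    by rewrite !modn_small ?di ?dk//; [move/eqP| exact: dk | exact: di].
  (* Surjectivity: the quotient of two points of the fibre has a root of unity in each coordinate,
     hence a power of [w j]. *)
  have root j : (val (val p).2 0 j / val y 0 j) ^+ N j = 1.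
    rewrite expr_div_n -!torus_endo_diagE sK (set_valP p) px divff//.
    exact: torus_neq0.
  pose i := [ffun j => widen_ord (index_size_le j) (tag (prim_rootP (hw j) (root j)))].
  exists i.
    by rewrite /= mem_enum; apply/familyP => j; rewrite ffunE unfold_in /=; exact: ltn_ord.
  apply/val_inj; rewrite [RHS]surjective_pairing px; congr pair.
  apply: torus_ext => j; rewrite /= mxE ffunE /=.
  by case: prim_rootP => k /= <-; rewrite mulrC divfK ?torus_neq0.
rewrite (reindex_fsbig _ _ _ _ hbij) -fsbig_seq ?enum_uniq// big_enum_cond.
by apply: eq_big => [i|i _]; rewrite ?andbT//=.
Qed.

(** The sum factors into geometric sums, and the one at [j] vanishes unless [a_j] divides [nu_j].
    The bound is on absolute values because [nu] will be a difference of two elements of [I(F)]. *)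
Lemma fibre_monomial (x : TT) (nu : 'rV[int]_d) : (forall j, `|nu 0%R j|%N < N j)%N ->
  \sum_(p \in [set p : OM | (val p).1 = x]) monomial R nu (val (p : OM)).2 =
  if nu == 0 then `|\det (diag_mx a)|%N%:R else 0.
Proof.
move=> nuN; have [y [w [hw sumE]]] := fibre_param x.
rewrite (sumE (fun v => \prod_(j < d) v 0 j ^ nu 0 j)).
have w0 j : w j != 0 by rewrite (prim_root_eq0 (hw j)) -lt0n index_size_gt0.
transitivity (\prod_(j < d) (val y 0 j ^ nu 0 j * \sum_(i < N j) (w j ^ nu 0 j) ^+ i)).
  under [RHS]eq_bigr do rewrite mulr_sumr.
  rewrite -(sum_digits (fun j i => val y 0 j ^ nu 0 j * (w j ^ nu 0 j) ^+ i)).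
  apply: eq_bigr => i _; apply: eq_bigr => j _; rewrite mxE expfzMl; congr (_ * _).
  by rewrite [w j ^+ i j]exprnP exprz_exp mulrC -exprz_exp -exprnP.
have root j : (w j ^ nu 0 j) ^+ N j = 1.
  by rewrite exprnP exprz_exp mulrC -exprz_exp -exprnP (prim_expr_order (hw j)) exp1rz.
under eq_bigr do rewrite sum_powers_root ?root//.
case: eqVneq => [->|nu0].
  rewrite absz_det_diag natr_prod; apply: eq_bigr => j _.
  by rewrite mxE !expr0z eqxx mul1r.
have [j nuj] : exists j, nu 0 j != 0.
  apply/existsP; apply: contraNT nu0 => /existsPn h.
  by apply/eqP/rowP => j; rewrite mxE; apply/eqP; have := h j; rewrite negbK.
rewrite (bigD1 j)//= ifF ?mulr0 ?mul0r//; apply/negP => /eqP w1.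
have {w1} : w j ^+ `|nu 0%R j|%N = 1.
  case: (nu 0 j) w1 => n //= /(congr1 GRing.inv).
  by rewrite invrK invr1.
move/eqP; rewrite -(prim_order_dvd (hw j)) => /dvdn_leq.
by have := nuN j; lia.
Qed.

End fibres.

(** * Finite-rank operators and covariant pairs *)

Section correspondence.
Variables (R : realType) (d : nat) (F G : 'M[int]_d) (detF : \det F != 0).
Local Notation C := (Cplx R).
Local Notation TT := (torus R d).
Local Notation A := (continuousType TT C).
Local Notation OM := (Omega R F G).
Local Notation E := (continuousType OM C).

Lemma ip_ractr (xi eta : E) (b : A) : ip xi (ract eta b) = ip xi eta ** b.
Proof.
apply/continuousEP => x; rewrite ipE//.
rewrite -[RHS]/(ip xi eta x * b x) ipE// /ip_fun -mulrA; congr (_ * _).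
rewrite !fsbig_finite; [|exact: fibre_finite..].
rewrite mulr_suml !big_seq; apply: eq_bigr => p.
rewrite in_fset_set ?inE; last exact: fibre_finite.
by move=> <-; rewrite -mulrA.
Qed.

Lemma ip_conj (xi eta : E) : star (ip xi eta) = ip eta xi.
Proof.
apply/continuousEP => x; transitivity ((ip_fun xi eta x)^*); first exact: (congr1 Num.conj (ipE xi eta x detF)).
transitivity (ip_fun eta xi x); last exact/esym/ipE.
rewrite /ip_fun.
rewrite rmorphM /=; congr (_ * _); first by rewrite conj_Creal// realV realn.
rewrite !fsbig_finite; [|exact: fibre_finite..].
rewrite rmorph_sum; apply: eq_bigr => p _.
by rewrite rmorphM /= conjCK mulrC.
Qed.

Lemma thetaE (xi eta zeta : E) (p : OM) :
  theta xi eta zeta p = `|\det F|%N%:R^-1 *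
    \sum_(q <- finmap.enum_fset (fset_set [set q : OM | (val q).1 = (val p).1]))
      zeta q * (xi p * (eta q)^*).
Proof.
transitivity (xi p * ip_fun eta zeta (val p).1).
  by rewrite -(ipE _ _ _ detF).
rewrite /ip_fun fsbig_finite; last exact: fibre_finite.
rewrite mulrCA; congr (_ * _); rewrite mulr_sumr; apply: eq_bigr => q _.
by rewrite [RHS]mulrCA [zeta q * _]mulrC.
Qed.

Lemma corr_norm_ge0 (xi : E) : 0 <= corr_norm xi.
Proof. exact: sqrtr_ge0. Qed.

Lemma corr_norm0 : corr_norm (0 : E) = 0.
Proof.
have ip00 : ip (0 : E) 0 = 0.
  have := ip_ractr (0 : E) 0 0; rewrite smulr0 => <-.
  by congr ip; rewrite /ract smul0r.
rewrite /corr_norm ip00 /sup_norm (_ : [set _ | _ in _] = [set 0]) ?sup1 ?sqrtr0//.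
apply/seteqP; split => [_ [x _ <-]|_ ->] /=.
  by rewrite /cabs /= expr0n addr0 sqrtr0.
(* The set of values equals [{0}] only if the torus has a point; this one serves. *)
have one1 : (const_mx 1 : 'rV[C]_d) \in [set z : 'rV[C]_d | forall j, `|z 0 j| = 1].
  by rewrite inE => j; rewrite mxE normr1.
exists (SigSub one1 : TT) => //.
by rewrite /cabs /= expr0n addr0 sqrtr0.
Qed.

Lemma compact_op_sum I (r : seq I) (xi eta : I -> E) :
  compact_op (fun zeta => \sum_(i <- r) theta (xi i) (eta i) zeta).
Proof.
move=> e e0; exists (size r), (fun i => xi (tnth (in_tuple r) i)),
  (fun i => eta (tnth (in_tuple r) i)) => zeta.
rewrite (big_tnth _ _ r) subrr corr_norm0.
by rewrite mulr_ge0 ?corr_norm_ge0// ltW.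
Qed.

Lemma compact_op_theta (xi eta : E) : compact_op (theta xi eta).
Proof.
have := @compact_op_sum unit [:: tt] (fun=> xi) (fun=> eta).
by congr compact_op; apply/funext => zeta; rewrite big_seq1.
Qed.

Lemma compact_hom_sum (B : cstarAlgType R) (T : E -> B) Psi I (r : seq I) (xi eta : I -> E) :
  compact_hom T Psi ->
  Psi (fun zeta => \sum_(i <- r) theta (xi i) (eta i) zeta) =
  \sum_(i <- r) T (xi i) ** star (T (eta i)).
Proof.
move=> hPsi; elim: r => [|i r IH].
  rewrite big_nil; set k := (fun _ => _).
  have kc : compact_op k := @compact_op_sum I [::] xi eta.
  (* Linearity of [Psi] with coefficient -1 gives [Psi 0 = 0]. *)
  have := compact_hom_linear hPsi (-1) kc kc; rewrite scaleN1r addNr => <-.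
  by congr Psi; apply/funext => zeta; rewrite /k big_nil scaler0 addr0.
rewrite big_cons -(compact_hom_theta hPsi) -IH -[Psi (theta _ _)]scale1r.
rewrite -(compact_hom_linear hPsi); [|exact: compact_op_theta|exact: compact_op_sum].
by congr Psi; apply/funext => zeta; rewrite big_cons scale1r.
Qed.

(** [torus_endo G] is surjective, so each [y] is the second coordinate of a point of [Omega]. Hence
    the kernel of the left action is 0 and its annihilator contains the unit. *)
Lemma lact_inj (detG : \det G != 0) (b : A) :
  (forall xi : E, lact b xi = 0) -> b = 0.
Proof.
move=> hb; apply/continuousEP => y.
have [s [sK _]] := torus_section_exists R detG.
have sP : (s (torus_endo F y), y) \in
    [set p : TT * TT | torus_endo F p.2 = torus_endo G p.1].
  by rewrite inE /= sK.
have := congr1 (fun f : E => f (SigSub sP)) (hb cf1).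
by rewrite -[LHS]/(b y * 1) mulr1.
Qed.

Section covariant.
Variables (B : cstarAlgType R) (T : E -> B) (pi : A -> B).
Hypothesis hT : covariant_pair T pi.
Let hpi := covariant_hom hT.

(** Right linearity follows from the inner product relation: by the C*-identity the squared norm of
    the difference expands into four inner products that cancel. *)
Lemma covariant_ract xi b : T (ract xi b) = T xi ** pi b.
Proof.
apply/eqP; rewrite -subr_eq0 -normr_eq0 -sqrf_eq0 -cstar_norm normr_eq0.
have ipT := covariant_ip hT; have piM := star_hom_mul hpi.
have ips : ip (ract xi b) xi = star b ** ip xi xi.
  by rewrite -ip_conj ip_ractr starM ip_conj.
set X := T (ract xi b); set Y := T xi; pose p := ip xi xi.
have YY : star Y ** Y = pi p by exact: ipT.
have YX : star Y ** X = pi (p ** b) by rewrite -ip_ractr; exact: ipT.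
have XY : star X ** Y = pi (star b ** p) by rewrite -ips; exact: ipT.
have XX : star X ** X = pi (star b ** p ** b).
  by rewrite -ips -ip_ractr; exact: ipT.
rewrite starB starM smulBl !smulBr -(star_hom_star hpi) !smulA.
rewrite XX XY -[_ ** star Y ** X]smulA YX -[_ ** star Y ** Y]smulA YY.
by rewrite -!piM !smulA !subrr.
Qed.

End covariant.

End correspondence.

(** * Sup-norm bounds for *-homomorphisms on continuous functions *)

Section continuous_function_algebra.
Variables (R : realType) (X : topologicalType) (B : cstarAlgType R).
Local Notation C := (Cplx R).
Local Notation CX := (continuousType X C).
Variable psi : CX -> B.
Hypothesis hpsi : star_hom psi.

Lemma real_complex_continuous : continuous (fun r : R => r%:C%C : C).
Proof.
move=> r; apply/cvgrPdist_lt => e /cplx_pos[s s0 ->].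
have /cvgrPdist_lt/(_ _ s0) := @cvg_id _ (nbhs r).
by apply: filterS => t; rewrite -rmorphB norm_real_complex ltcR.
Qed.

Lemma Re_continuous : continuous (fun z : C => complex.Re z).
Proof.
move=> z; apply/(@cvgrPdist_lt _ _ _ (nbhs z) (nbhs_filter z)) => e e0.
have e0c : 0 < e%:C%C :> C by rewrite ltcR.
apply: (@filterS _ (nbhs z) (nbhs_filter z)) (nbhsx_ballx z _ e0c) => w.
rewrite -ball_normE /=; rewrite -raddfB /= => /(le_lt_trans _); rewrite -ltcR; apply.
exact: normc_ge_Re.
Qed.

(** [CX] is only a *-algebra here, so the bound on [h] is pointwise, and so is the square root of
    [1 - h^2] fed to [star_hom_contraction]. *)
Lemma star_hom_real (h : CX) : star h = h -> (forall x, `|h x| <= 1) -> `|psi h| <= 1.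
Proof.
move=> hs h1.
have hE x : h x = (complex.Re (h x))%:C%C.
  have := congr1 (fun f : CX => f x) hs; rewrite -[LHS]/((h x)^*).
  case: (h x) => u v; rewrite -[LHS]/(u -i* v)%C => -[/eqP].
  by rewrite eq_sym -addr_eq0 -mulr2n mulrn_eq0/= => /eqP ->.
have yc : continuous (fun x => (Num.sqrt (1 - complex.Re (h x) ^+ 2))%:C%C : C).
  move=> x.
  have hr : complex.Re (h y) @[y --> x] --> complex.Re (h x).
    exact: (cvg_comp _ _ (@cts_fun _ _ h x) (@Re_continuous _)).
  have sq : 1 - complex.Re (h y) ^+ 2 @[y --> x] --> 1 - complex.Re (h x) ^+ 2.
    apply: cvgB; first exact: cvg_cst.
    by rewrite expr2; under eq_cvg do rewrite expr2; exact: cvgM.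
  exact: (cvg_comp _ _ (cvg_comp _ _ sq (@sqrt_continuous R _)) (@real_complex_continuous _)).
apply: (@star_hom_contraction _ _ _ psi (cf1 : CX) h (mkcts yc)) => //.
- by apply/continuousEP => x; exact: conjC1.
- by apply/continuousEP => x; exact: mulr1.
- apply/continuousEP => x; rewrite -[LHS]/(((Num.sqrt (1 - complex.Re (h x) ^+ 2))%:C%C : C)^*).
  by rewrite -[LHS]/(_ -i* _)%C oppr0.
- by apply/continuousEP => x; exact: mulrC.
- apply/continuousEP => x.
  rewrite -[LHS]/((Num.sqrt (1 - complex.Re (h x) ^+ 2))%:C%C * (Num.sqrt (1 - complex.Re (h x) ^+ 2))%:C%C : C).
  rewrite -[RHS]/(1 - h x * h x) hE -!rmorphM -expr2 sqr_sqrtr ?rmorphB//.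
  rewrite subr_ge0 -real_normK ?num_real// expr_le1//.
  by rewrite -lecR -norm_real_complex -hE.
Qed.

Lemma star_hom_cts_bounded (f : CX) (c : C) : 0 < c -> (forall x, `|f x| <= c) ->
  `|psi f| <= 2 * c.
Proof.
move=> c0 fc.
(* The real and imaginary parts of [f / c]. *)
pose h1 : CX := (2 * c)^-1 *: (f + star f); pose h2 : CX := ('i / (2 * c)) *: (star f - f).
have c20 : 0 < 2 * c by rewrite mulr_gt0.
have c2r : ((2 * c)^-1)^* = (2 * c)^-1 by rewrite conj_Creal// ger0_real// invr_ge0 ltW.
have h1s : star h1 = h1 by rewrite starZ starD starK c2r addrC.
have h2s : star h2 = h2.
  by rewrite starZ starB starK rmorphM /= c2r conjCi mulNr scaleNr -scalerN opprB.
have nc2 : `|(2 * c)^-1| = (2 * c)^-1 by rewrite ger0_norm// invr_ge0 ltW.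
have h11 x : `|h1 x| <= 1.
  rewrite -[h1 x]/((2 * c)^-1 * (f x + (f x)^*)) normrM nc2 ler_pdivrMl// mulr1.
  rewrite (le_trans (ler_normD _ _))// norm_conjC mulr2n mulrDl mul1r.
  by rewrite lerD.
have h21 x : `|h2 x| <= 1.
  rewrite -[h2 x]/('i / (2 * c) * ((f x)^* - f x)) !normrM normCi mul1r nc2.
  rewrite ler_pdivrMl// mulr1.
  rewrite (le_trans (ler_normB _ _))// norm_conjC mulr2n mulrDl mul1r.
  by rewrite lerD.
have -> : f = c *: (h1 + 'i *: h2).
  have i2 : 'i * 'i = -1 :> C by rewrite -expr2 sqrCi.
  apply/continuousEP => x.
  rewrite -[RHS]/(c * ((2 * c)^-1 * (f x + (f x)^*) + 'i * ('i / (2 * c) * ((f x)^* - f x)))).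
  rewrite ![in RHS]mulrA i2; have c00 : c != 0 by rewrite gt_eqF.
  by field.
have n1 : `|psi h1| <= 1 by exact: star_hom_real.
have n2 : `|psi h2| <= 1 by exact: star_hom_real.
rewrite (star_homZ hpsi c) (star_homD hpsi) (star_homZ hpsi 'i) normrZ (gtr0_norm c0).
rewrite mulrC ler_wpM2r ?(ltW c0)// (le_trans (ler_normD _ _))//.
by rewrite [`|'i *: _|]normrZ normCi mul1r (le_trans (lerD n1 n2)).
Qed.

End continuous_function_algebra.

Lemma closed_fixed_points (K : numFieldType) (V : normedModType K) (f : V -> V) :
  continuous f -> closed [set x | f x = x].
Proof.
move=> fc; have -> : [set x | f x = x] = (fun x => f x - x) @^-1` [set 0].
  by apply/seteqP; split => x /= => [->|/eqP]; rewrite ?subrr// subr_eq0 => /eqP.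
apply: closed_comp => [x _|]; first exact: (cvgB (fc x) (@cvg_id _ (nbhs x))).
exact/accessible_closed_set1/hausdorff_accessible/norm_hausdorff.
Qed.

(** * Relations between the generators and the finite frame *)

Section generators.
Variables (R : realType) (d : nat) (a : 'rV[int]_d) (G : 'M[int]_d).
Hypothesis a_gt0 : forall j, 0 < a 0 j.
Local Notation C := (Cplx R).
Local Notation TT := (torus R d).
Local Notation A := (continuousType TT C).
Local Notation OM := (Omega R (diag_mx a) G).
Local Notation E := (continuousType OM C).
Variables (O : cstarAlgType R) (T : E -> O) (pi : A -> O).
Hypothesis OTpi : cuntz_pimsner T pi.
Implicit Types mu nu : 'rV[int]_d.
Let hT := cuntz_pimsner_pair OTpi.
Let hpi := covariant_hom hT.
Let detF := det_diag_neq0 a_gt0.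
Local Notation N j := `|a 0%R j|%N.

Lemma lact1 xi : lact cf1 xi = xi :> E.
Proof. by apply/continuousEP => p; exact: mul1r. Qed.

Lemma ract1 xi : ract xi cf1 = xi :> E.
Proof. by apply/continuousEP => p; exact: mulr1. Qed.

Lemma cf1E (X : topologicalType) (x : X) : (cf1 : continuousType X C) x = 1.
Proof. by []. Qed.

Lemma lactE (b : A) (xi : E) (p : OM) : lact b xi p = b (val p).2 * xi p.
Proof. by []. Qed.

Lemma ractE (b : A) (xi : E) (p : OM) : ract xi b p = xi p * b (val p).1.
Proof. by []. Qed.

Lemma smul1_cf (f : A) : cf1 ** f = f.
Proof. by apply/continuousEP => p; exact: mul1r. Qed.

Lemma smul_cf1 (f : A) : f ** cf1 = f.
Proof. by apply/continuousEP => p; exact: mulr1. Qed.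

(** The elements on which [pi cf1] acts trivially from both sides form a closed *-subalgebra
    containing the images of [T] and [pi], hence everything. *)
Lemma gen_one_identity : is_identity (gen_one pi).
Proof.
have one_star : star (gen_one pi) = gen_one pi.
  rewrite -(star_hom_star hpi); congr pi; apply/continuousEP => p; exact: conjC1.
suff DT : [set x | gen_one pi ** x = x] `&` [set x | x ** gen_one pi = x] = setT.
  by move=> x; have : [set: O] x by []; rewrite -DT.
apply: (cuntz_pimsner_gen OTpi).
- split=> [|c x y [/= x1 x2] [/= y1 y2]|x y [/= x1 x2] [/= y1 y2]|x [/= x1 x2]].
  + by split => /=; rewrite ?smulr0 ?smul0r.
  + by split => /=; rewrite ?smulDr ?smulDl ?smulZr ?smulZl ?x1 ?x2 ?y1 ?y2.
  + by split => /=; [rewrite smulA x1 | rewrite -smulA y2].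
  + by split; rewrite /= -[in LHS]one_star -starM ?x1 ?x2.
- apply: closedI; apply: closed_fixed_points.
    exact: smull_continuous.
  exact: smulr_continuous.
- move=> xi; split => /=.
    by rewrite -(covariant_lact hT) lact1.
  by rewrite -(covariant_ract detF hT) ract1.
- by move=> f; split; rewrite /= -(star_hom_mul hpi) ?smul1_cf ?smul_cf1.
Qed.

Lemma iter_smul_pi (f : A) m :
  iter m (smul (pi f)) (gen_one pi) = pi (iter m (smul f) cf1).
Proof. by elim: m => [//|m IH]; rewrite /= IH -(star_hom_mul hpi). Qed.

Lemma iter_smulE (f : A) m z : iter m (smul f) cf1 z = f z ^+ m.
Proof.
elim: m => [//|m IH]; rewrite exprS -IH.
by rewrite -[LHS]/(f z * iter m (smul f) cf1 z).
Qed.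

(** Turns identities between powers of the [U_j] into identities of functions; negative powers agree
    because inverse and conjugate coincide on the circle. *)
Lemma gen_UpowE nu : gen_Upow pi nu = pi (monomial R nu).
Proof.
pose g j : A := match nu 0 j with
  | Posz m => iter m (smul (torus_coord R j)) cf1
  | Negz m => iter m.+1 (smul (star (torus_coord R j))) cf1
  end.
have powE j : gen_pow pi (gen_U pi j) (nu 0 j) = pi (g j).
  by rewrite /g /gen_pow /gen_U; case: (nu 0 j) => m; rewrite -?(star_hom_star hpi) iter_smul_pi.
rewrite /gen_Upow; under eq_bigr do rewrite powE.
rewrite -(big_morph pi (star_hom_mul hpi) (erefl (gen_one pi))); congr pi.
apply/continuousEP => z; rewrite monomialE.
have evM : {morph (fun f : A => f z) : f h / f ** h >-> f * h} by [].
rewrite (big_morph (fun f : A => f z) evM (erefl : (cf1 : A) z = 1)).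
apply: eq_bigr => j _; rewrite /g; case: (nu 0 j) => m; rewrite iter_smulE //.
rewrite -[LHS]/((val z 0 j)^* ^+ m.+1) NegzE -exprz_inv -exprnP; congr (_ ^+ _).
by rewrite invC_norm torus_norm expr1n invr1 mul1r.
Qed.

Lemma star_gen_Upow nu : star (gen_Upow pi nu) = gen_Upow pi (- nu).
Proof.
rewrite !gen_UpowE -(star_hom_star hpi); congr pi.
by apply/continuousEP => z; exact: monomial_conj.
Qed.

Lemma gen_UpowD mu nu : gen_Upow pi (mu + nu) = gen_Upow pi mu ** gen_Upow pi nu.
Proof.
rewrite !gen_UpowE -(star_hom_mul hpi); congr pi.
by apply/continuousEP => z; exact: monomialD.
Qed.

Lemma gen_Upow0 : gen_Upow pi 0 = gen_one pi.
Proof.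
by rewrite gen_UpowE; congr pi; apply/continuousEP => z; exact: monomial0.
Qed.

Lemma gen_SnuE nu : gen_Snu T pi nu = T (lact (monomial R nu) cf1).
Proof. by rewrite /gen_Snu gen_UpowE -(covariant_lact hT). Qed.

(* On [Omega], [y^(Fn) = sigma_F(y)^n = sigma_G(x)^n = x^(G^T n)]. *)
Lemma gen_Upow_S nu :
  gen_Upow pi (\row_j (a 0 j * nu 0 j)) ** gen_S T =
  gen_S T ** gen_Upow pi (nu *m G).
Proof.
rewrite !gen_UpowE -(covariant_lact hT) -(covariant_ract detF hT); congr T.
apply/continuousEP => p.
rewrite lactE ractE !cf1E mulr1 mul1r !monomialE.
have -> : \prod_j val (val p).2 0 j ^ (\row_j (a 0 j * nu 0 j)) 0 j =
    \prod_j val (torus_endo G (val p).1) 0 j ^ nu 0 j.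
  apply: eq_bigr => j _; rewrite -(set_valP p) torus_endo_diagE// mxE -exprz_exp.
  by rewrite exprnP gez0_abs// ltW.
under eq_bigr => j _.
  rewrite torus_endoE (big_morph (fun x : C => x ^ nu 0 j) (id1 := 1) (op1 := *%R)).
  - under eq_bigr do rewrite exprz_exp; over.
  - by move=> x y; rewrite expfzMl.
  - by rewrite exp1rz.
rewrite exchange_big; apply: eq_bigr => k _; rewrite mxE.
rewrite (big_morph (fun n : int => val (val p).1 0 k ^ n) (id1 := 1) (op1 := *%R)) //.
  by apply: eq_bigr => j _; rewrite mulrC.
by move=> m n; rewrite expfzDr// torus_neq0.
Qed.

Lemma star_S_Upow_S nu : (forall j, `|nu 0%R j|%N < N j)%N ->
  star (gen_S T) ** gen_Upow pi nu ** gen_S T = if nu == 0 then gen_one pi else 0.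
Proof.
move=> nuN; rewrite gen_UpowE -smulA -(covariant_lact hT) (covariant_ip hT).
have -> : ip (cf1 : E) (lact (monomial R nu) cf1) = if nu == 0 then cf1 else 0.
  apply/continuousEP => x; rewrite (ipE _ _ _ detF) /ip_fun.
  under eq_fsbigr do rewrite lactE !cf1E conjC1 mul1r mulr1.
  rewrite fibre_monomial//; case: (nu == 0); last exact: mulr0.
  by rewrite mulVf// pnatr_eq0 absz_eq0.
by case: (nu == 0) => [//|]; exact: (star_hom0 hpi).
Qed.

Definition digits : seq 'rV[int]_d :=
  [seq \row_j (val (i j))%:Z | i : {ffun 'I_d -> 'I_(digit_bound a)} in family (digit (a := a))].

Lemma mem_digits nu : nu \in digits <-> index_set a nu.
Proof.
rewrite /digits /image_mem; split=> [h|nuI].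
  case: (elimT mapP h) => i.
  rewrite mem_enum => /familyP di -> j; rewrite mxE; by have := di j; rewrite unfold_in /=; have := a_gt0 j; lia.
have bound j : (`|nu 0%R j| < digit_bound a)%N.
  by apply: leq_trans (index_size_le a j); have := nuI j; have := a_gt0 j; lia.
apply/mapP; exists [ffun j => Ordinal (bound j)].
  by rewrite mem_enum; apply/familyP => j; rewrite ffunE unfold_in /=; have := nuI j; have := a_gt0 j; lia.
by apply/rowP => j; rewrite mxE ffunE /=; have := nuI j; lia.
Qed.

(** The orthogonality dual to [fibre_monomial]: the sum runs over characters, at two points with the
    same image under [torus_endo (diag_mx a)]. *)
Lemma sum_digits_monomial (y z : TT) : (forall j, val y 0 j ^+ N j = val z 0 j ^+ N j) ->
  \sum_(nu <- digits) monomial R nu y * (monomial R nu z)^* =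
  if y == z then `|\det (diag_mx a)|%N%:R else 0.
Proof.
move=> yz; rewrite /digits big_image_cond /=.
transitivity (\prod_(j < d) \sum_(i < N j) (val y 0 j / val z 0 j) ^+ i).
  rewrite -(sum_digits a (fun j i => (val y 0 j / val z 0 j) ^+ i)); apply: eq_big => [i|i _]; first by rewrite andbT.
  rewrite monomial_conj !monomialE -big_split; apply: eq_bigr => j _ /=.
  by rewrite !mxE expr_div_n -invr_expz !exprnP.
have root j : (val y 0 j / val z 0 j) ^+ N j = 1.
  by rewrite expr_div_n yz divff// expf_neq0// torus_neq0.
under eq_bigr do rewrite sum_powers_root ?root//.
case: eqVneq => [->|nyz].
  rewrite absz_det_diag natr_prod; apply: eq_bigr => j _.
  by rewrite divff ?torus_neq0// eqxx.
have [j yzj] : exists j, val y 0 j != val z 0 j.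
  apply/existsP; apply: contraNT nyz => /existsPn h.
  by apply/eqP/torus_ext => j; apply/eqP; have := h j; rewrite negbK.
rewrite (bigD1 j)//= ifF ?mul0r//; apply: contraNF yzj => /eqP e.
by rewrite -[val y 0 j](divfK (torus_neq0 z j)) e mul1r.
Qed.

(** After exchanging the sums over [nu] and over the fibre, [sum_digits_monomial] leaves only the
    point [q = p]. *)
Lemma frame_reconstruction (zeta : E) :
  \sum_(nu <- digits) theta (lact (monomial R nu) cf1) (lact (monomial R nu) cf1) zeta = zeta.
Proof.
apply/continuousEP => p; set x := (val p).1.
have evD : {morph (fun f : E => f p) : f h / f + h >-> f + h} by [].
rewrite (big_morph (fun f : E => f p) evD (erefl : (0 : E) p = 0)).
have fin : finite_set [set q : OM | (val q).1 = x] by exact: fibre_finite.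
pose S := finmap.enum_fset (fset_set [set q : OM | (val q).1 = x]).
under eq_bigr => nu _.
  rewrite thetaE//.
  under eq_bigr do rewrite !lactE !cf1E !mulr1.
  over.
rewrite -/x -/S -mulr_sumr exchange_big /=.
transitivity (`|\det (diag_mx a)|%N%:R^-1 *
    \sum_(q <- S) (if q == p then zeta p * `|\det (diag_mx a)|%N%:R else 0)).
  congr (_ * _); rewrite !big_seq; apply: eq_bigr => q; rewrite in_fset_set// inE /= => qx.
  have e : torus_endo (diag_mx a) (val p).2 = torus_endo (diag_mx a) (val q).2.
    by rewrite (set_valP p) (set_valP q) qx.
  transitivity (zeta q * (if (val p).2 == (val q).2 then `|\det (diag_mx a)|%N%:R else 0)).
    rewrite -mulr_sumr; congr (_ * _); apply: sum_digits_monomial => j.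
    have := congr1 (fun z : TT => val z 0 j) e.
    by rewrite (torus_endo_diagE a_gt0 (val p).2 j) (torus_endo_diagE a_gt0 (val q).2 j).
  case: (eqVneq q p) => [->|qp]; first by rewrite eqxx.
  rewrite ifF ?mulr0//; apply/negP => /eqP e2; case/eqP: qp; apply/val_inj.
  by rewrite [LHS]surjective_pairing [RHS]surjective_pairing qx e2.
have pS : p \in S by rewrite in_fset_set// inE.
rewrite (bigD1_seq p)//= ?finmap.fset_uniq// eqxx big1 => [|q /negbTE ->//].
by rewrite addr0 mulrCA mulVf ?mulr1// pnatr_eq0 absz_eq0.
Qed.

(** Division with remainder by [a_j] in each coordinate: the remainder is the digit, and the
    multiple of [a] passes through [S] by [gen_Upow_S]. *)
Lemma digit_decomposition nu : exists2 mu, mu \in digits &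
  exists n, gen_Upow pi nu ** gen_S T = gen_Snu T pi mu ** gen_Upow pi n.
Proof.
exists (\row_j (nu 0%R j %% a 0%R j)%Z).
  apply/mem_digits => j; rewrite mxE; have := a_gt0 j.
  by have := modz_ge0 (nu 0 j) (lt0r_neq0 (a_gt0 j)); have := ltz_pmod (nu 0 j) (a_gt0 j); lia.
exists ((\row_j (nu 0%R j %/ a 0%R j)%Z) *m G).
rewrite /gen_Snu -smulA -gen_Upow_S smulA -gen_UpowD; congr (gen_Upow pi _ ** _).
by apply/rowP => j; rewrite !mxE addrC mulrC -divz_eq.
Qed.

Lemma star_gen_Snu mu nu : mu \in digits -> nu \in digits ->
  star (gen_Snu T pi mu) ** gen_Snu T pi nu = if mu == nu then gen_one pi else 0.
Proof.
move=> /mem_digits hmu /mem_digits hnu.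
rewrite /gen_Snu starM star_gen_Upow -smulA [gen_Upow _ _ ** (_ ** _)]smulA -gen_UpowD smulA.
rewrite star_S_Upow_S => [|j]; first by rewrite addrC subr_eq0 eq_sym.
rewrite !mxE; move: (hmu j) (hnu j); move: (mu 0 j) (nu 0 j) (a 0 j) => x y z.
by rewrite -[X in absz X]/((- x + y : int)%R); lia.
Qed.

Hypothesis detG : \det G != 0.

(** By the frame, the left action of the unit is a finite sum of rank-one operators, hence compact.
    Covariance applies to it because the left action is injective. *)
Lemma sum_gen_Snu : \sum_(nu <- digits) gen_Snu T pi nu ** star (gen_Snu T pi nu) = gen_one pi.
Proof.
have [Psi [hPsi PsiE]] := covariant_compact hT.
pose xi nu : E := lact (monomial R nu) cf1.
have idE : lact cf1 = (fun zeta : E => \sum_(nu <- digits) theta (xi nu) (xi nu) zeta).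
  by apply/funext => zeta; rewrite frame_reconstruction lact1.
rewrite /gen_one -PsiE.
- rewrite idE (compact_hom_sum detF _ _ _ hPsi); apply: eq_bigr => nu _.
  by rewrite gen_SnuE.
- by rewrite idE; exact: (compact_op_sum detF).
- by move=> b hb; rewrite (lact_inj detG hb) smulr0.
Qed.

Lemma T_span (xi : E) :
  T xi = \sum_(nu <- digits) gen_Snu T pi nu ** pi (ip (lact (monomial R nu) cf1) xi).
Proof.
rewrite -[LHS](gen_one_identity _).1 -sum_gen_Snu smul_suml; apply: eq_bigr => nu _.
by rewrite -smulA gen_SnuE (covariant_ip hT).
Qed.

End generators.

(** * Words in the S_nu and the gauge action *)

Section core.
Variables (R : realType) (d : nat) (a : 'rV[int]_d) (G : 'M[int]_d).
Hypotheses (a_gt0 : forall j, 0 < a 0 j) (detG : \det G != 0).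
Local Notation C := (Cplx R).
Local Notation TT := (torus R d).
Local Notation A := (continuousType TT C).
Local Notation OM := (Omega R (diag_mx a) G).
Local Notation E := (continuousType OM C).
Variables (O : cstarAlgType R) (T : E -> O) (pi : A -> O).
Hypothesis OTpi : cuntz_pimsner T pi.
Implicit Types (mu nu : 'rV[int]_d) (alpha beta : seq 'rV[int]_d).
Let hT := cuntz_pimsner_pair OTpi.
Let hpi := covariant_hom hT.
Local Notation one := (gen_one pi).
Local Notation U := (gen_Upow pi).
Local Notation S := (gen_Salpha T pi).
Local Notation Sn := (gen_Snu T pi).
Let one1 := gen_one_identity a_gt0 OTpi.

Lemma gen_Salpha_nil : S [::] = one.
Proof. by rewrite /gen_Salpha big_nil. Qed.

Lemma gen_Salpha_cons nu alpha : S (nu :: alpha) = Sn nu ** S alpha.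
Proof. by rewrite /gen_Salpha big_cons. Qed.

Lemma gen_Salpha_rcons alpha nu : S (rcons alpha nu) = S alpha ** Sn nu.
Proof.
elim: alpha => [|mu alpha IH].
  by rewrite gen_Salpha_cons gen_Salpha_nil (one1 _).1 (one1 _).2.
by rewrite rcons_cons !gen_Salpha_cons IH smulA.
Qed.

(** Sequences with a length condition instead of tuples, so that adding and removing letters needs
    no casts; [core_levelE] translates. *)
Definition word k alpha := size alpha = k /\ {subset alpha <= digits a}.

Lemma word_cons k nu alpha : word k.+1 (nu :: alpha) -> nu \in digits a /\ word k alpha.
Proof.
move=> [[sz] sub]; split; first by apply: sub; rewrite mem_head.
by split=> // mu hmu; apply: sub; rewrite inE hmu orbT.
Qed.

Lemma word_rcons k nu alpha : nu \in digits a -> word k alpha -> word k.+1 (rcons alpha nu).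
Proof.
move=> hnu [sz sub]; split; first by rewrite size_rcons sz.
by move=> mu; rewrite mem_rcons inE => /predU1P[->|/sub].
Qed.

(** The first letters meet in the middle and give 0 or the identity, which leaves shorter words. *)
Lemma star_gen_Salpha k alpha beta : word k alpha -> word k beta ->
  star (S alpha) ** S beta = if alpha == beta then one else 0.
Proof.
elim: k alpha beta => [|k IH] alpha beta.
  move=> [/size0nil -> _] [/size0nil -> _].
  by rewrite eqxx gen_Salpha_nil (one1 _).2 (star_identity one1).
case: alpha => [[]//|mu alpha]; case: beta => [_ []//|nu beta].
move=> /word_cons[hmu ha] /word_cons[hnu hb].
rewrite !gen_Salpha_cons starM smulA -[_ ** star (Sn mu) ** _]smulA (star_gen_Snu a_gt0 OTpi hmu hnu).
rewrite eqseq_cons; case: (mu == nu); last by rewrite smulr0 smul0r.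
by rewrite (one1 _).2 IH.
Qed.

Lemma gen_Upow_Snu nu mu : exists2 mu', mu' \in digits a &
  exists n, U nu ** Sn mu = Sn mu' ** U n.
Proof.
have [mu' hmu' [n hn]] := digit_decomposition a_gt0 OTpi (nu + mu).
exists mu' => //; exists n; rewrite -hn /gen_Snu smulA.
by rewrite (gen_UpowD OTpi).
Qed.

Definition monomials k l : set O := [set x | exists alpha beta nu,
  [/\ word k alpha, word l beta & x = S alpha ** U nu ** star (S beta)]].

Lemma monomials_star k l x : monomials k l x -> monomials l k (star x).
Proof.
move=> [alpha [beta [nu [ha hb ->]]]]; exists beta, alpha, (- nu); split => //.
by rewrite !starM starK (star_gen_Upow OTpi) smulA.
Qed.

(** The inserted sum of [Sn mu ** star (Sn mu)] stands before [star (S beta)]. Moving [U nu] past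
    [Sn mu] changes the letter added to [alpha], while [beta] receives [mu] itself. *)
Lemma monomials_raise k l : monomials k l `<=` lspan (monomials k.+1 l.+1).
Proof.
move=> _ [alpha [beta [nu [ha hb ->]]]].
rewrite -[star (S beta)](one1 _).1 -(sum_gen_Snu a_gt0 OTpi detG) smul_suml smul_sumr.
rewrite big_seq; elim/big_ind : _ => [|x y hx hy|mu hmu]; first exact: lspan0.
  by rewrite -[x]scale1r; exact: lspan_linear.
apply: sub_lspan; have [mu' hmu' [n hn]] := gen_Upow_Snu nu mu.
exists (rcons alpha mu'), (rcons beta mu), n; split; [exact: word_rcons..|].
rewrite !gen_Salpha_rcons starM -[Sn mu ** _ ** _]smulA [LHS]smulA; congr (_ ** _).
by rewrite -[LHS]smulA hn smulA.
Qed.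

Lemma level_raise k l m :
  lspan (monomials k l) `<=` lspan (monomials (m + k) (m + l)).
Proof.
elim: m => [|m IH] x hx //; rewrite !addSn.
have := IH x hx; move: x {hx}; apply: lspan_min; first exact: lspan0.
  by move=> c x y; exact: lspan_linear.
exact: monomials_raise.
Qed.

Lemma monomials_mul k l m x y : monomials k l x -> monomials l m y ->
  lspan (monomials k m) (x ** y).
Proof.
move=> [alpha [beta [mu [ha hb ->]]]] [alpha' [beta' [nu [ha' hb' ->]]]].
have -> : S alpha ** U mu ** star (S beta) ** (S alpha' ** U nu ** star (S beta')) =
    S alpha ** U mu ** (star (S beta) ** S alpha') ** U nu ** star (S beta').
  by rewrite !smulA.
rewrite (star_gen_Salpha hb ha'); case: (beta == alpha'); last first.
  by rewrite smulr0 !smul0r; exact: lspan0.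
apply: sub_lspan; exists alpha, beta', (mu + nu); split => //.
by rewrite (one1 _).2 (gen_UpowD OTpi) !smulA.
Qed.

Lemma level_mul k l m x y : lspan (monomials k l) x -> lspan (monomials l m) y ->
  lspan (monomials k m) (x ** y).
Proof.
move=> hx hy; move: x hx; apply: lspan_min => [|c u v hu hv|x Xx].
- by rewrite smul0r; exact: lspan0.
- by rewrite smulDl smulZl; exact: lspan_linear.
- move: y hy; apply: lspan_min => [|c u v hu hv|y Xy].
  + by rewrite smulr0; exact: lspan0.
  + by rewrite smulDr smulZr; exact: lspan_linear.
  + exact: monomials_mul Xx Xy.
Qed.

Lemma monomials_one : monomials 0 0 one.
Proof.
exists [::], [::], 0; split => //.
by rewrite gen_Salpha_nil (gen_Upow0 OTpi) (star_identity one1) !(one1 _).1.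
Qed.

Lemma core_levelE k : core_level T pi k = closure (lspan (monomials k k)).
Proof.
congr (closure (lspan _)); apply/seteqP; split => x.
  move=> [alpha [beta [nu [ha hb ->]]]]; exists alpha, beta, nu; split => //.
    by split; [rewrite size_tuple | move=> _ /tnthP[i ->]; exact/mem_digits].
  by split; [rewrite size_tuple | move=> _ /tnthP[i ->]; exact/mem_digits].
move=> [alpha [beta [nu [[sa ha] [sb hb] ->]]]].
exists (tcast sa (in_tuple alpha)), (tcast sb (in_tuple beta)), nu.
split; last by rewrite !val_tcast.
  by move=> i; apply/(mem_digits a_gt0)/ha; rewrite -[X in _ \in X](val_tcast sa (in_tuple alpha)) mem_tnth.
by move=> i; apply/(mem_digits a_gt0)/hb; rewrite -[X in _ \in X](val_tcast sb (in_tuple beta)) mem_tnth.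
Qed.

Lemma core_level_subalgebra k : star_subalgebra (core_level T pi k).
Proof.
rewrite core_levelE; apply/closure_star_subalgebra/star_subalgebra_lspan.
  by move=> x y; exact: monomials_mul.
exact: monomials_star.
Qed.

Lemma core_level_one k : core_level T pi k one.
Proof.
rewrite core_levelE; apply: subset_closure.
by have := level_raise k (sub_lspan monomials_one); rewrite addn0.
Qed.

Lemma core_level_mono k m : core_level T pi k `<=` core_level T pi (m + k).
Proof. by rewrite !core_levelE; apply: closure_subset; exact: level_raise. Qed.

Definition all_monomials : set O := [set x | exists k l, monomials k l x].

Lemma level_sub_all k l : lspan (monomials k l) `<=` lspan all_monomials.
Proof.
apply: lspan_min => [|c x y|x Xx]; [exact: lspan0|exact: lspan_linear|].
by apply: sub_lspan; exists k, l.
Qed.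

(** The left factor is raised by [m] and the right one by [l], so both inner words get length
    [l + m]. *)
Lemma all_monomials_subalgebra : star_subalgebra (lspan all_monomials).
Proof.
apply: star_subalgebra_lspan => [x y [k [l Xx]] [m [n Xy]]|x [k [l Xx]]]; last first.
  by exists l, k; exact: monomials_star.
have hx := level_raise m (sub_lspan Xx); have := level_raise l (sub_lspan Xy).
by rewrite [(l + m)%N]addnC => hy; exact/level_sub_all/(level_mul hx hy).
Qed.

Lemma preimage_pi_subalgebra (D : set O) : star_subalgebra D -> D one ->
  star_subalgebra [set f | D (pi f)].
Proof.
move=> [D0 DP DM Ds] D1; split => /=; first by rewrite (star_hom0 hpi).
- by move=> c f g hf hg; rewrite (star_hom_linear hpi); exact: DP.
- by move=> f g hf hg; rewrite (star_hom_mul hpi); exact: DM.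
- by move=> f hf; rewrite (star_hom_star hpi); exact: Ds.
Qed.

(** The preimage of [D] under [pi] contains approximants of every function, and [pi] is bounded by
    twice the sup norm, whence the tolerance [e / 4]. *)
Lemma pi_in_closed (D : set O) : star_subalgebra D -> closed D -> D one ->
  (forall j, D (gen_U pi j)) -> forall f, D (pi f).
Proof.
move=> hD cD D1 DU f.
suff : closure D (pi f) by rewrite -(closure_id _).1.
apply/closure_normP => e e0.
have e4 : 0 < e / 4 by rewrite divr_gt0.
have [g Dg fg] := trigonometric_density (preimage_pi_subalgebra hD D1) D1 DU f e4.
exists (pi g) => //; rewrite -(star_homB hpi).
apply: le_lt_trans (star_hom_cts_bounded hpi e4 _) _; first exact: fg.
have -> : 2 * (e / 4) = e / 2 by field.
by rewrite ltr_pdivrMr// ltr_pMr// ltr1n.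
Qed.

Lemma all_monomials_U j : lspan all_monomials (gen_U pi j).
Proof.
apply: sub_lspan; exists 0%N, 0%N, [::], [::], (delta_mx 0 j); split => //.
rewrite gen_Salpha_nil (star_identity one1) (one1 _).1 (one1 _).2 (gen_UpowE OTpi).
congr pi; apply/continuousEP => z; rewrite monomialE (bigD1 j)//= big1 => [|k /negbTE kj].
  by rewrite mxE !eqxx mulr1 expr1z.
by rewrite mxE kj andbF expr0z.
Qed.

(** The closure contains the image of [pi] by [pi_in_closed], then that of [T] by the frame
    expansion [T_span], so it is everything by generation. *)
Lemma all_monomials_dense : closure (lspan all_monomials) = setT.
Proof.
have hD := closure_star_subalgebra all_monomials_subalgebra.
have D1 : closure (lspan all_monomials) one.
  by apply/subset_closure/level_sub_all/sub_lspan/monomials_one.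
have Dpi f : closure (lspan all_monomials) (pi f).
  apply: pi_in_closed => //; first exact: closed_closure.
  by move=> j; exact/subset_closure/all_monomials_U.
apply: (cuntz_pimsner_gen OTpi) => //; first exact: closed_closure.
move=> xi; rewrite (T_span a_gt0 OTpi detG) big_seq.
elim/big_ind : _ => [|x y hx hy|mu hmu]; first exact: (star_subalgebra0 hD).
  by rewrite -[x]scale1r; exact: (star_subalgebraP hD).
apply: (star_subalgebraM hD) => //; apply/subset_closure/sub_lspan.
exists 1%N, 0%N, [:: mu], [::], 0; split => //.
  by split => // nu; rewrite inE => /eqP ->.
rewrite gen_Salpha_cons gen_Salpha_nil (gen_Upow0 OTpi) (star_identity one1).
by rewrite !(one1 _).2.
Qed.

(** * Fixed points of the gauge action *)

Section gauge.
Variable gamma : C -> O -> O.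
Hypothesis gammaP : gauge_action T pi gamma.

(** A surjective homomorphism preserves the identity; surjectivity comes from [gauge_bij]. *)
Lemma gauge_one t : `|t| = 1 -> gamma t one = one.
Proof.
move=> t1; have [g _ gK] := gauge_bij gammaP t1; have hg := gauge_hom gammaP t1.
by rewrite -[LHS](one1 _).1 -{1}[one]gK -(star_hom_mul hg) (one1 _).2 gK.
Qed.

Lemma gauge_Upow t nu : `|t| = 1 -> gamma t (U nu) = U nu.
Proof.
move=> t1; have hg := gauge_hom gammaP t1; rewrite /gen_Upow.
rewrite (big_morph _ (star_hom_mul hg) (gauge_one t1)); apply: eq_bigr => j _.
have it u m : gamma t u = u -> gamma t (iter m (smul u) one) = iter m (smul u) one.
  move=> hu; elim: m => [|m IH]; first exact: gauge_one.
  by rewrite /= (star_hom_mul hg) hu IH.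
rewrite /gen_pow; case: (nu 0 j) => m; rewrite it ?(star_hom_star hg)//.
  exact: (gauge_U gammaP).
by rewrite (gauge_U gammaP).
Qed.

Lemma gauge_Salpha t alpha : `|t| = 1 -> gamma t (S alpha) = t ^+ size alpha *: S alpha.
Proof.
move=> t1; have hg := gauge_hom gammaP t1.
elim: alpha => [|nu alpha IH]; first by rewrite gen_Salpha_nil scale1r gauge_one.
rewrite gen_Salpha_cons (star_hom_mul hg) IH {1}/gen_Snu (star_hom_mul hg).
by rewrite gauge_Upow// (gauge_S gammaP t1) !smulZr smulZl scalerA -exprSr.
Qed.

Lemma gauge_monomials t k l x : `|t| = 1 -> monomials k l x ->
  gamma t x = (t ^+ k / t ^+ l) *: x.
Proof.
move=> t1 [alpha [beta [nu [[<- _] [<- _] ->]]]]; have hg := gauge_hom gammaP t1.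
rewrite !(star_hom_mul hg) (star_hom_star hg) gauge_Upow// !gauge_Salpha// starZ.
rewrite !smulZl smulZr scalerA; congr (_ *: _).
by rewrite rmorphXn -exprVn [t^-1]invC_norm t1 expr1n invr1 mul1r.
Qed.

Lemma gauge_fixed_closed : closed (gauge_fixed gamma).
Proof.
have -> : gauge_fixed gamma = \bigcap_(t in [set t | `|t| = 1]) [set x | gamma t x = x].
  by apply/seteqP; split.
apply: closed_bigI => t t1; apply: closed_fixed_points.
exact: (star_hom_continuous one1 (gauge_hom gammaP t1)).
Qed.

Lemma core_level_fixed k : core_level T pi k `<=` gauge_fixed gamma.
Proof.
rewrite core_levelE [X in _ `<=` X](closure_id _).1; last exact: gauge_fixed_closed.
apply: closure_subset; apply: lspan_min => [t t1|c x y hx hy t t1|x Xx t t1].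
- exact: (star_hom0 (gauge_hom gammaP t1)).
- by rewrite (star_hom_linear (gauge_hom gammaP t1)) hx// hy.
- rewrite (gauge_monomials t1 Xx) divff ?scale1r// expf_neq0//.
  by rewrite -normr_eq0 t1 oner_eq0.
Qed.

(** For [w] a primitive [n]-th root of unity, a discrete substitute for the integral of [gamma t x]
    over the circle. *)
Definition gauge_average n (w : C) (x : O) : O := n%:R^-1 *: \sum_(s < n) gamma (w ^+ s) x.

Section average.
Variables (n : nat) (w : C).
Hypotheses (n_gt0 : (0 < n)%N) (wn : n.-primitive_root w).

Let w1 s : `|w ^+ s| = 1.
Proof.
rewrite normrX; have -> : `|w| = 1; last by rewrite expr1n.
by apply/eqP; rewrite -(@pexpr_eq1 _ _ n)// -normrX (prim_expr_order wn) normr1.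
Qed.

Let n0 : n%:R != 0 :> C. Proof. by rewrite pnatr_eq0 -lt0n. Qed.

Lemma gauge_average_linear c x y : gauge_average n w (c *: x + y) =
  c *: gauge_average n w x + gauge_average n w y.
Proof.
rewrite /gauge_average scalerA mulrC -scalerA -scalerDr [c *: \sum_(_ < _) _]scaler_sumr -big_split /=.
congr (_ *: _); apply: eq_bigr => s _.
exact: (star_hom_linear (gauge_hom gammaP (w1 s))).
Qed.

Lemma gauge_average_bounded x : `|gauge_average n w x| <= 2 * `|x|.
Proof.
rewrite normrZ ger0_norm ?invr_ge0// ler_pdivrMl ?ltr0n//.
rewrite (le_trans (ler_norm_sum _ _ _))//.
have -> : n%:R * (2 * `|x|) = \sum_(s < n) 2 * `|x|.
  by rewrite sumr_const card_ord -[RHS]mulr_natl.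
apply: ler_sum => s _.
exact: (star_hom_bounded one1 _ (gauge_hom gammaP (w1 s))).
Qed.

Lemma gauge_average_fixed x : gauge_fixed gamma x -> gauge_average n w x = x.
Proof.
move=> hx; rewrite /gauge_average (eq_bigr (fun=> x)) => [|s _]; last by rewrite hx.
by rewrite sumr_const card_ord -[x *+ n]scaler_nat scalerA mulVf// scale1r.
Qed.

(** The average vanishes unless [n] divides [k - l]; with both lengths below [n] this means
    [k = l]. *)
Lemma gauge_average_monomials k l x : (k < n)%N -> (l < n)%N -> monomials k l x ->
  gauge_average n w x = if k == l then x else 0.
Proof.
move=> kn ln Xx; rewrite /gauge_average.
have w0 : w != 0 by rewrite (prim_root_eq0 wn) -lt0n.
have gE s : gamma (w ^+ s) x = (w ^+ k / w ^+ l) ^+ s *: x.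
  rewrite (gauge_monomials (w1 s) Xx); congr (_ *: _).
  by rewrite exprMn exprVn -!exprM ![(s * _)%N]mulnC.
under eq_bigr do rewrite gE.
rewrite -scaler_suml sum_powers_root; last first.
  by rewrite exprMn exprVn -!exprM ![(_ * n)%N]mulnC !exprM (prim_expr_order wn) !expr1n invr1 mulr1.
have -> : (w ^+ k / w ^+ l == 1) = (k == l).
  rewrite -(inj_eq (mulIf (expf_neq0 l w0))) divfK ?expf_neq0// mul1r.
  by rewrite (eq_prim_root_expr wn) !modn_small.
case: eqP => _; last by rewrite scale0r scaler0.
by rewrite scalerA mulVf// scale1r.
Qed.

End average.

Lemma core_levels_directed (c : C) x y :
  (\bigcup_k core_level T pi k) x -> (\bigcup_k core_level T pi k) y ->
  (\bigcup_k core_level T pi k) (c *: x + y).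
Proof.
move=> [k _ hx] [l _ hy]; exists (k + l)%N => //.
apply: (star_subalgebraP (core_level_subalgebra _)).
  by rewrite addnC; exact: core_level_mono.
exact: core_level_mono.
Qed.

(** Asking for all [n] above a threshold makes the property stable under linear combinations: the
    larger threshold serves both terms. *)
Lemma gauge_average_core x : lspan all_monomials x -> exists m, forall n w,
  (m < n)%N -> n.-primitive_root w -> (\bigcup_k core_level T pi k) (gauge_average n w x).
Proof.
move: x; apply: lspan_min => [|c x y [m1 h1] [m2 h2]|x [k [l Xx]]].
- exists 0%N => n w n0 wn; rewrite gauge_average_fixed//.
    by exists 0%N => //; exact: (star_subalgebra0 (core_level_subalgebra 0)).
  by move=> t t1; exact: (star_hom0 (gauge_hom gammaP t1)).
- exists (maxn m1 m2) => n w; rewrite gtn_max => /andP[n1 n2] wn.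
  rewrite gauge_average_linear ?(leq_ltn_trans _ n1)//.
  by apply: core_levels_directed; [exact: h1 | exact: h2].
- exists (maxn k l) => n w; rewrite gtn_max => /andP[kn ln] wn.
  rewrite (gauge_average_monomials _ wn kn ln Xx) ?(leq_ltn_trans _ kn)//.
  case: eqP Xx => [<- Xx|_ _]; last first.
    by exists 0%N => //; exact: (star_subalgebra0 (core_level_subalgebra 0)).
  by exists k => //; rewrite core_levelE; exact/subset_closure/sub_lspan.
Qed.

Lemma gauge_fixedE : gauge_fixed gamma = closure (\bigcup_k core_level T pi k).
Proof.
apply/seteqP; split=> [x hx|]; last first.
  rewrite [X in _ `<=` X](closure_id _).1; last exact: gauge_fixed_closed.
  by apply: closure_subset => x [k _]; exact: core_level_fixed.
(* Averaging fixes [x] and at most doubles the distance to the approximant [z], hence [e / 2]. *)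
apply/closure_normP => e e0; have e2 : 0 < e / 2 by rewrite divr_gt0.
have : closure (lspan all_monomials) x by rewrite all_monomials_dense.
move=> /closure_normP/(_ _ e2)[z hz xz].
have [m hm] := gauge_average_core hz; have [w wm] := @primitive_root_exists C m.+1 isT.
exists (gauge_average m.+1 w z); first exact: hm.
rewrite -[x in x - _](gauge_average_fixed (n := m.+1) _ wm hx)//.
have -> : gauge_average m.+1 w x - gauge_average m.+1 w z = gauge_average m.+1 w (x - z).
  by rewrite addrC -scaleN1r -gauge_average_linear// scaleN1r addrC.
apply: le_lt_trans (gauge_average_bounded _ wm _) _ => //.
by rewrite mulrC -ltr_pdivlMr.
Qed.

End gauge.
End core.

Theorem proposition5p2 (R : realType) (d : nat) (a : 'rV[int]_d)
    (G : 'M[int]_d) (a_gt0 : forall j, 0 < a 0 j) (detG : \det G != 0)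
    (O : cstarAlgType R)
    (T : continuousType (Omega R (diag_mx a) G) (Cplx R) -> O)
    (pi : continuousType (torus R d) (Cplx R) -> O)
    (OTpi : cuntz_pimsner T pi)
    (gamma : Cplx R -> O -> O) (gammaP : gauge_action T pi gamma) :
  (forall k : nat,
    [/\ star_subalgebra (core_level T pi k),
        is_identity (gen_one pi) /\ core_level T pi k (gen_one pi),
        core_level T pi k `<=` gauge_fixed gamma
      & core_level T pi k `<=` core_level T pi k.+1]) /\
  gauge_fixed gamma = closure (\bigcup_k core_level T pi k).
Proof.
split=> [k|]; last exact: (gauge_fixedE a_gt0 detG OTpi gammaP).
split.
- exact: (core_level_subalgebra a_gt0 OTpi).
- split; first exact: (gen_one_identity a_gt0 OTpi).
  exact: (core_level_one a_gt0 detG OTpi).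
- exact: (core_level_fixed a_gt0 OTpi gammaP).
- exact: (core_level_mono a_gt0 detG OTpi 1).
Qed.
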